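(* Let $E$ be a Hermite--Biehler function with phase function $\phi$ and with $\sigma=0$, and suppose that a subsequence of the zeros of $E$ converges to infinity. Then $\phi'(x)\,dx$ is a locally doubling measure on $\mathbb{R}$ if and only if the inner function $\Theta=E^*/E$ on $\mathbb{C}_+$ satisfies the one component condition.
   Context: An entire function $E$ is a Hermite--Biehler function if it has no real zeros and $|E^*(z)|<|E(z)|$ for all $z\in\mathbb{C}_+=\{z\in\mathbb{C}:\operatorname{Im}z>0\}$, where $E^*(z)=\overline{E(\bar z)}$. Its phase function is the (smooth, increasing) function $\phi$ on $\mathbb{R}$ with $E(x)=|E(x)|e^{-i\phi(x)}$. For some $\sigma\ge 0$ one has $\phi'(x)=\sigma+\sum_{z\in Z(E)}\operatorname{Im}\frac{1}{x-\bar z}$, where $Z(E)$ is the zero set of $E$ (with multiplicity); $\sigma$ denotes this number. A positive Borel measure $\mu$ on $\mathbb{R}$ is locally doubling if there is a constant $C>0$ with $\mu(2I)\le C\mu(I)$ for every bounded interval $I$ such that $\mu(2I)<1$, where $2I$ is the interval co-centric with $I$ of double length. An inner function $\Theta$ on $\mathbb{C}_+$ satisfies the one component condition if there exists $\epsilon\in(0,1)$ such that the level set $\{z\in\mathbb{C}_+:|\Theta(z)|<\epsilon\}$ is connected. *)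

(* Defs.v *)
From HB Require Import structures.
From mathcomp Require Import all_boot all_order all_algebra.
From mathcomp Require Import all_classical all_reals all_analysis.
From mathcomp Require Export complex.

Set Implicit Arguments.
Unset Strict Implicit.
Unset Printing Implicit Defensive.

Import Order.TTheory GRing.Theory Num.Theory numFieldNormedType.Exports.

Local Open Scope ring_scope.
Local Open Scope classical_set_scope.
Local Open Scope complex_scope.

(* R[i] gets its topology and its normed-module structure over itself through
   the alias R[i]^o; derivability of a map R[i]^o -> R[i]^o in the direction 1
   is then differentiability in the complex sense. *)
Definition entire (R : realType) (f : R[i] -> R[i]) : Prop :=
  forall z : R[i], derivable (f : R[i]^o -> R[i]^o) z 1.

Definition upper_half_plane (R : realType) : set R[i] :=
  [set z | 0 < complex.Im z].

Definition star (R : realType) (f : R[i] -> R[i]) : R[i] -> R[i] :=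
  fun z => conjc (f (conjc z)).

Definition hermite_biehler (R : realType) (E : R[i] -> R[i]) : Prop :=
  [/\ entire E,
      forall x : R, E x%:C != 0 &
      forall z : R[i], upper_half_plane z -> `|star E z| < `|E z| ].

Definition zeros (R : realType) (E : R[i] -> R[i]) : set R[i] :=
  [set z | E z = 0].

Definition vanishing_order (R : realType) (E : R[i] -> R[i]) (z : R[i])
    (m : nat) : Prop :=
  exists g : R[i] -> R[i],
    [/\ entire g, g z != 0 & forall w, E w = (w - z) ^+ m * g w].

(* The order is unique, and exists unless E vanishes identically (then 0). *)
Definition multiplicity (R : realType) (E : R[i] -> R[i]) (z : R[i]) : nat :=
  xget 0%N [set m | vanishing_order E z m].

(* e^{-i phi} is written cos phi - i sin phi. *)
Definition phase_function (R : realType) (E : R[i] -> R[i]) (phi : R -> R) :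
    Prop :=
  [/\ forall (n : nat) (x : R), derivable (phi^`(n)) x 1,
      {homo phi : x y / x < y} &
      forall x : R, E x%:C = `|E x%:C| * (cos (phi x) -i* sin (phi x)) ].

(* The zeros of a Hermite-Biehler function lie in the open lower half-plane,
   so all terms of the unordered sum are positive. *)
Definition phase_sigma (R : realType) (E : R[i] -> R[i]) (phi : R -> R)
    (sigma : R) : Prop :=
  0 <= sigma /\
  forall x : R,
    (derive1 phi x)%:E =
    (sigma%:E + \esum_(z in zeros E)
       ((multiplicity E z)%:R * complex.Im ((x%:C - conjc z)^-1))%:E)%E :> \bar R.

Definition zeros_tend_to_infinity (R : realType) (E : R[i] -> R[i]) :
    Prop :=
  exists u : nat -> R[i],
    (forall n, zeros E (u n)) /\ Normc.normc (u n) @[n --> \oo] --> +oo.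

(* The measure f(x) dx, for a nonnegative measurable density f. *)
Definition density_measure (R : realType) (f : R -> R) : set R -> \bar R :=
  fun A => (\int[@lebesgue_measure R]_(x in A) (f x)%:E)%E.

(* The endpoint a belongs to the interval iff s = true, and b iff t = false. *)
Definition bounded_itv (R : realType) (s t : bool) (a b : R) : set R :=
  [set` Interval (BSide s a) (BSide t b)].

Definition double_itv (R : realType) (s t : bool) (a b : R) : set R :=
  bounded_itv s t (a - (b - a) / 2) (b + (b - a) / 2).

(* No measure property of mu enters the condition, so mu is any set function;
   in particular it may be any Borel measure on R. *)
Definition locally_doubling (R : realType) (mu : set R -> \bar R) : Prop :=
  exists2 C : R, 0 < C &
    forall (s t : bool) (a b : R), a < b ->
      (mu (double_itv s t a b) < 1)%E ->
      (mu (double_itv s t a b) <= C%:E * mu (bounded_itv s t a b))%E.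

Definition one_component (R : realType) (Theta : R[i] -> R[i]) : Prop :=
  exists eps : R,
    [/\ 0 < eps, eps < 1 &
        connected ([set z | upper_half_plane z /\ `|Theta z| < eps%:C]
                    : set R[i]^o) ].

(* Main.v *)
Require Import Defs.
From mathcomp Require Import all_boot all_order all_algebra.
From mathcomp Require Import all_classical all_reals all_analysis.
From mathcomp Require Import measurable_realfun ring lra.
Import numFieldNormedType.Exports.
Import Order.TTheory GRing.Theory Num.Theory.
Local Open Scope ring_scope.
Local Open Scope classical_set_scope.
Local Open Scope complex_scope.
Set Implicit Arguments.
Unset Strict Implicit.
Unset Printing Implicit Defensive.

(** The zeros of E lie in the open lower half-plane; their conjugates a are the
zeros of Theta, and with multiplicities m_a the hypothesis sigma = 0 reads
F x = phi' x = sum_a m_a Im a / |x - a|^2.  Both sides of the equivalence are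
shown to be equivalent to one separation property: there is c > 0 with
c <= |x - a| F x for all real x and all zeros a.

Product formula (HB_blaschke_product).  |Theta| is the infimum of the moduli of
the finite Blaschke products over the zeros.  Dividing E by finitely many
zeros shows that Theta / B is holomorphic up to the real line, unimodular on it
and bounded by 1 by the maximum principle.  On the real line Theta is
exp (2 i phi) and B has an explicit argument, so sigma = 0 makes Theta / B nearly
constant on bounded real intervals once B has enough factors; square_trick
carries this smallness into the upper half-plane.  The only complex analysis
needed is the maximum principle for complex differentiable functions, which is
derived from Goursat's theorem (goursat) through the mean value inequality
Re_le_circle.

Doubling and separation.  mu (a, b) = phi b - phi a.  A zero at distance d from x
puts mass at least 1 within 2 d of x, so two doublings from the radius of mass
1/2, where all zeros are relatively far, bound F x from below
(doubling_separated).  Conversely separation gives Harnack's inequality for F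
at every scale up to 1 / F, hence |F'| <= (2 / c) F^2, so that ln F varies by at
most (2 / c) mu (I) on an interval I (separated_doubling).

Separation implies one component. For y <= c / F x all zeros are at distance at
least y from x, so every Blaschke factor decreases in modulus as x + i y moves
up to the graph y = c / F x; on this graph one has |Theta|^2 <= exp (- c / 2),
hence above the graph as well, by the maximum principle. A level set of height
between exp (- c / 4) and 1 therefore retracts vertically to the graph
(separated_one_component).

One component implies separation. Let a be a zero at distance d from x. As the
zeros are unbounded, a connected level set meets every circle of radius r about
x with d <= r <= 2 d. The Green potential of the measure dr / Im w(r) carried by
points w(r) of the level set on these circles is bounded off the hyperbolic
balls about the w(r), because the integral of y / (y^2 + (r - r0)^2) over r is.
On these balls Theta is small, so a multiple of - ln |Theta| dominates the
potential off the balls. At x + i d / 2, where the potential is bounded below,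
|Theta| is therefore bounded away from 1, whether or not this point is in a
ball; and 1 - |Theta|^2 <= 2 d F x there (one_component_separated). A
discretization of the measure turns the potential into - ln |B| for a finite
Blaschke product B, and the comparison into the maximum principle for Theta^N /
B. *)

(** * The modulus and complex differentiability *)

Notation nc := Normc.normc.
Notation Re := complex.Re.
Notation Im := complex.Im.

Section ComplexNorm.
Context {R : realType}.
Implicit Types (z w u : R[i]) (x y : R).

Lemma nc_ge0 z : 0 <= nc z.
Proof. by case: z => a b; rewrite /= sqrtr_ge0. Qed.

Lemma sqr_nc z : nc z ^+ 2 = Re z ^+ 2 + Im z ^+ 2.
Proof. by case: z => a b; rewrite /= sqr_sqrtr // addr_ge0 // sqr_ge0. Qed.

Lemma norm_nc z : `|z| = (nc z)%:C.
Proof. by rewrite normc_def; case: z. Qed.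

Lemma nc0 : nc (0 : R[i]) = 0. Proof. exact: Normc.normc0. Qed.
Lemma nc1 : nc (1 : R[i]) = 1. Proof. exact: Normc.normc1. Qed.
Lemma ncM z w : nc (z * w) = nc z * nc w. Proof. exact: Normc.normcM. Qed.
Lemma ncV z : nc z^-1 = (nc z)^-1. Proof. exact: Normc.normcV. Qed.
Lemma ncN z : nc (- z) = nc z. Proof. exact: normcN. Qed.

Lemma ncX z n : nc (z ^+ n) = nc z ^+ n.
Proof.
by elim: n => [|n IH]; rewrite ?expr0 ?nc1 // !exprS ncM IH.
Qed.

Lemma nc_conj z : nc (conjc z) = nc z.
Proof. by case: z => a b; rewrite /= sqrrN. Qed.

Lemma nc_real x : nc x%:C = `|x|.
Proof. by rewrite /= expr0n /= addr0 sqrtr_sqr. Qed.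

Lemma nc_distC z w : nc (z - w) = nc (w - z).
Proof. by rewrite -opprB ncN. Qed.

Lemma nc_eq0 z : (nc z == 0) = (z == 0).
Proof.
by apply/eqP/eqP => [/Normc.eq0_normc //|->]; exact: nc0.
Qed.

Lemma nc_gt0 z : (0 < nc z) = (z != 0).
Proof. by rewrite lt0r nc_eq0 nc_ge0 andbT. Qed.

Lemma ler_ncD z w : nc (z + w) <= nc z + nc w.
Proof. exact: le_normcD. Qed.

Lemma ler_ncB z w : nc (z - w) <= nc z + nc w.
Proof. by apply: le_trans (ler_ncD _ _) _; rewrite ncN. Qed.

Lemma ler_nc_dist u z w : nc (z - w) <= nc (z - u) + nc (u - w).
Proof.
have -> : z - w = (z - u) + (u - w) by rewrite addrA subrK.
exact: ler_ncD.
Qed.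

Lemma ler_dist_nc z w : `|nc z - nc w| <= nc (z - w).
Proof.
rewrite ler_norml; apply/andP; split.
  have := ler_ncD (w - z) z; rewrite subrK nc_distC; lra.
have := ler_ncD (z - w) w; rewrite subrK; lra.
Qed.

Lemma ler_Re_nc z : `|Re z| <= nc z.
Proof.
rewrite -ler_sqr ?nnegrE ?nc_ge0 // sqr_nc real_normK ?num_real //.
by rewrite lerDl sqr_ge0.
Qed.

Lemma ler_Im_nc z : `|Im z| <= nc z.
Proof.
rewrite -ler_sqr ?nnegrE ?nc_ge0 // sqr_nc real_normK ?num_real //.
by rewrite lerDr sqr_ge0.
Qed.

Lemma ler_nc_ReIm z : nc z <= `|Re z| + `|Im z|.
Proof.
rewrite -ler_sqr ?nnegrE ?nc_ge0 ?addr_ge0 // sqr_nc sqrrD !real_normK ?num_real //.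
by rewrite lerD2r lerDl mulrn_wge0 // mulr_ge0.
Qed.

Lemma ReD z w : Re (z + w) = Re z + Re w. Proof. by case: z; case: w. Qed.
Lemma ImD z w : Im (z + w) = Im z + Im w. Proof. by case: z; case: w. Qed.
Lemma ReN z : Re (- z) = - Re z. Proof. by case: z. Qed.
Lemma ImN z : Im (- z) = - Im z. Proof. by case: z. Qed.
Lemma ReB z w : Re (z - w) = Re z - Re w. Proof. by rewrite ReD ReN. Qed.
Lemma ImB z w : Im (z - w) = Im z - Im w. Proof. by rewrite ImD ImN. Qed.
Lemma ReM z w : Re (z * w) = Re z * Re w - Im z * Im w.
Proof. by case: z; case: w. Qed.
Lemma ImM z w : Im (z * w) = Re z * Im w + Im z * Re w.
Proof. by case: z; case: w. Qed.
Lemma Re_conj z : Re (conjc z) = Re z. Proof. by case: z. Qed.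
Lemma Im_conj z : Im (conjc z) = - Im z. Proof. by case: z. Qed.

Definition ReImE := (ReB, ImB, ReD, ImD, ReN, ImN, ReM, ImM, Re_conj, Im_conj).

Lemma complex_eqP z w : Re z = Re w -> Im z = Im w -> z = w.
Proof. by case: z; case: w => a b c d /= -> ->. Qed.

End ComplexNorm.

(** Complex differentiability, in the form of Caratheodory: the difference
quotient extends continuously.  In this form the calculus rules are algebraic
identities. *)
Definition cdiff {R : realType} (f : R[i] -> R[i]) (z : R[i]) : Prop :=
  exists2 q : R[i] -> R[i], {for z, continuous (q : R[i]^o -> R[i]^o)} &
    forall w, f w = f z + q w * (w - z).

Section Cdiff.
Context {R : realType}.
Implicit Types (z w u : R[i]) (f g : R[i] -> R[i]).

Lemma nbhs_ncP z (A : set R[i]) :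
  nbhs (z : R[i]^o) A <->
  exists2 d : R, 0 < d & forall w, nc (w - z) < d -> A w.
Proof.
split.
  move=> /nbhs_ballP [e /=]; rewrite ltcE /= => /andP[/eqP ei e0] H.
  exists (Re e) => // w wz; apply: H => /=; rewrite -ball_normE /=.
  by rewrite norm_nc nc_distC ltcE /= ei eqxx.
move=> [d d0 H]; apply/nbhs_ballP; exists d%:C => /=; first by rewrite ltcR.
by move=> w /=; rewrite -ball_normE /= norm_nc nc_distC ltcR; exact: H.
Qed.

Lemma ccontP f z : {for z, continuous (f : R[i]^o -> R[i]^o)} <->
  forall e : R, 0 < e -> exists2 d : R, 0 < d &
    forall w, nc (w - z) < d -> nc (f w - f z) < e.
Proof.
split.
  move=> fz e e0.
  have /fz /= : nbhs (f z : R[i]^o) [set w | nc (w - f z) < e].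
    by apply/nbhs_ncP; exists e.
  by move=> /nbhs_ncP.
move=> H A /= /nbhs_ncP[e e0 HA].
have [d d0 Hd] := H _ e0.
by apply/nbhs_ncP; exists d => // w /Hd; exact: HA.
Qed.

Lemma rcontP (g : R[i] -> R) z : {for z, continuous (g : R[i]^o -> R)} <->
  forall e : R, 0 < e -> exists2 d : R, 0 < d &
    forall w, nc (w - z) < d -> `|g w - g z| < e.
Proof.
split.
  move=> fz e e0.
  have /fz /= : nbhs (g z) [set w | `|w - g z| < e].
    by apply/nbhs_ballP; exists e => //= w; rewrite -ball_normE /= distrC.
  by move=> /nbhs_ncP.
move=> H A /= /nbhs_ballP[e /= e0 HA].
have [d d0 Hd] := H _ e0.
apply/nbhs_ncP; exists d => // w /Hd ?; apply: HA; by rewrite -ball_normE /= distrC.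
Qed.

Lemma lip_rcont (g : R[i] -> R) z :
  (forall w, `|g w - g z| <= nc (w - z)) -> {for z, continuous (g : R[i]^o -> R)}.
Proof.
move=> H; apply/rcontP => e e0; exists e => // w; exact: le_lt_trans.
Qed.

Lemma cont_Re z : {for z, continuous (fun w : R[i]^o => Re w : R)}.
Proof. by apply: lip_rcont => w; rewrite -ReB ler_Re_nc. Qed.

Lemma cont_Im z : {for z, continuous (fun w : R[i]^o => Im w : R)}.
Proof. by apply: lip_rcont => w; rewrite -ImB ler_Im_nc. Qed.

Lemma cont_nc z : {for z, continuous (fun w : R[i]^o => nc w : R)}.
Proof. by apply: lip_rcont => w; exact: ler_dist_nc. Qed.

Lemma cdiff_derivable f z :
  derivable (f : R[i]^o -> R[i]^o) z 1 -> cdiff f z.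
Proof.
rewrite /derivable => /cvg_ex [l Hl].
exists (fun w => if w == z then l else (f w - f z) / (w - z)); last first.
  move=> w; case: eqP => [->|/eqP wz]; first by rewrite subrr mulr0 addr0.
  by rewrite divfK ?subr_eq0 // addrC subrK.
apply/ccontP => e e0.
have /Hl : nbhs (l : R[i]^o) [set w | nc (w - l) < e].
  by apply/nbhs_ncP; exists e.
rewrite /= nbhs_simpl /= => /nbhs_ncP[d d0 Hd].
exists d => // w wd; rewrite eqxx; case: eqP => [_|/eqP wz].
  by rewrite subrr nc0.
have := Hd (w - z); rewrite subr0 => /(_ wd); rewrite subr_eq0 => /(_ wz) /=.
by rewrite /GRing.scale /= mulr1 subrK mulrC.
Qed.

Local Notation ccont f z := {for z, continuous (f : R[i]^o -> R[i]^o)}.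

Lemma ccont_cst (c : R[i]) z : ccont (fun=> c) z.
Proof. by apply/ccontP => e e0; exists 1 => // w _; rewrite subrr nc0. Qed.

Lemma ccont_id z : ccont id z.
Proof. by apply/ccontP => e e0; exists e. Qed.

Lemma ccontD f g z : ccont f z -> ccont g z -> ccont (fun w => f w + g w) z.
Proof. move=> fz gz; exact: (cvgD fz gz). Qed.

Lemma ccontM f g z : ccont f z -> ccont g z -> ccont (fun w => f w * g w) z.
Proof. move=> fz gz; exact: (cvgM fz gz). Qed.

Lemma ccontN f z : ccont f z -> ccont (fun w => - f w) z.
Proof. move=> fz; exact: (cvgN fz). Qed.

Lemma ccontV f z : f z != 0 -> ccont f z -> ccont (fun w => (f w)^-1) z.
Proof. move=> f0 fz; exact: (cvgV f0 fz). Qed.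

Lemma ccont_comp f g z : ccont f z -> ccont g (f z) -> ccont (fun w => g (f w)) z.
Proof. move=> fz gz; exact: (continuous_comp fz gz). Qed.

Lemma cdiff_cont f z : cdiff f z -> {for z, continuous (f : R[i]^o -> R[i]^o)}.
Proof.
move=> [q qz E].
have := ccontD (@ccont_cst (f z) z)
  (ccontM qz (ccontD (@ccont_id z) (@ccont_cst (- z) z))).
by rewrite (_ : (fun w => _ + _) = f) //; apply/funext => w; rewrite -E.
Qed.

Lemma cdiff_ext f g z : f =1 g -> cdiff f z -> cdiff g z.
Proof. by move=> /funext ->. Qed.

(** Continuity at z constrains the quotient near z only; off the ball the plain
difference quotient of g serves. *)
Lemma cdiff_near f g z (d : R) : 0 < d -> (forall w, nc (w - z) < d -> f w = g w) ->
  cdiff f z -> cdiff g z.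
Proof.
move=> d0 E [q qz H].
have Ez : f z = g z by apply: E; rewrite subrr nc0.
exists (fun w => if nc (w - z) < d then q w else (g w - g z) / (w - z)); last first.
  move=> w; case: ifPn => [wd|]; first by rewrite -E // H Ez.
  rewrite -leNgt => wd; rewrite divfK; first by rewrite addrC subrK.
  by rewrite -nc_gt0; exact: lt_le_trans d0 wd.
apply/ccontP => e e0; have /ccontP/(_ e e0)[d' d'0 Hd] := qz.
exists (Num.min d d'); first by rewrite lt_min d0.
move=> w; rewrite lt_min subrr nc0 d0 => /andP[-> ?]; exact: Hd.
Qed.

Lemma cdiff_cst (c : R[i]) z : cdiff (fun=> c) z.
Proof.
exists (fun=> 0); first exact: ccont_cst.
by move=> w; rewrite mul0r addr0.
Qed.

Lemma cdiff_id z : cdiff id z.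
Proof.
exists (fun=> 1); first exact: ccont_cst.
by move=> w; rewrite mul1r addrC subrK.
Qed.

Lemma cdiffD f g z : cdiff f z -> cdiff g z -> cdiff (fun w => f w + g w) z.
Proof.
move=> [p pz F] [q qz G]; exists (fun w => p w + q w).
  exact: ccontD.
by move=> w; rewrite F G; ring.
Qed.

Lemma cdiffM f g z : cdiff f z -> cdiff g z -> cdiff (fun w => f w * g w) z.
Proof.
move=> df [q qz G]; have [p pz F] := df.
exists (fun w => p w * g z + f w * q w).
  apply: ccontD.
    exact: (ccontM pz (@ccont_cst (g z) z)).
  exact: (ccontM (cdiff_cont df) qz).
by move=> w; rewrite [in LHS]G mulrDr [in f w * g z]F; ring.
Qed.

Lemma cdiffN f z : cdiff f z -> cdiff (fun w => - f w) z.
Proof.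
move=> /(cdiffM (cdiff_cst (-1) z)); apply: cdiff_ext => w; exact: mulN1r.
Qed.

Lemma cdiffB f g z : cdiff f z -> cdiff g z -> cdiff (fun w => f w - g w) z.
Proof. by move=> df /cdiffN; exact: cdiffD. Qed.

Lemma cdiffX f n z : cdiff f z -> cdiff (fun w => f w ^+ n) z.
Proof.
move=> df; elim: n => [|n IH].
  by apply: cdiff_ext (cdiff_cst 1 z) => w; rewrite expr0.
by apply: cdiff_ext (cdiffM df IH) => w; rewrite exprS.
Qed.

Lemma cdiff_comp f g z : cdiff f z -> cdiff g (f z) -> cdiff (fun w => g (f w)) z.
Proof.
move=> df [q qz G]; have [p pz F] := df.
exists (fun w => q (f w) * p w); last first.
  by move=> w; rewrite G (_ : f w - f z = p w * (w - z)) ?mulrA // F addrC addKr.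
exact: (ccontM (ccont_comp (cdiff_cont df) qz) pz).
Qed.

(** The factor q below is only valid away from 0, where the value of the inverse
is a convention; the function is therefore changed at 0. *)
Lemma cdiff_inv z : z != 0 -> cdiff (fun w => w^-1) z.
Proof.
move=> z0.
apply: (@cdiff_near (fun w => if w == 0 then z^-1 + (z * w)^-1 else w^-1) _ _ (nc z)).
- by rewrite nc_gt0.
- move=> w; case: eqP => // ->; by rewrite sub0r ncN ltxx.
exists (fun w => - (z * w)^-1); last first.
  move=> w; rewrite (negbTE z0); have [->|w0] := eqVneq w 0.
    rewrite mulr0 invr0; ring.
  by field; apply/andP; split.
apply: ccontN; apply: (@ccontV (fun w => z * w)); first by rewrite mulf_neq0.
exact: (ccontM (@ccont_cst z z) (@ccont_id z)).
Qed.

Lemma cdiffV f z : f z != 0 -> cdiff f z -> cdiff (fun w => (f w)^-1) z.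
Proof. by move=> fz df; apply: (@cdiff_comp f (fun w => w^-1)) => //; exact: cdiff_inv. Qed.

Lemma cdiff_div f g z : g z != 0 -> cdiff f z -> cdiff g z ->
  cdiff (fun w => f w / g w) z.
Proof. by move=> gz df dg; apply: cdiffM => //; exact: cdiffV. Qed.

Lemma cdiff_star f z : cdiff f (conjc z) -> cdiff (star f) z.
Proof.
move=> [q qz F]; exists (fun w => conjc (q (conjc w))); last first.
  by move=> w; rewrite /star [in LHS]F rmorphD rmorphM rmorphB /= !conjcK.
apply/ccontP => e e0; have /ccontP/(_ e e0)[d d0 H] := qz.
exists d => // w wd; rewrite -rmorphB nc_conj; apply: H.
by rewrite -rmorphB nc_conj.
Qed.

Lemma cdiff_prod (I : Type) (r : seq I) (f : I -> R[i] -> R[i]) z :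
  (forall i, cdiff (f i) z) -> cdiff (fun w => \prod_(i <- r) f i w) z.
Proof.
move=> df; elim: r => [|i r IH].
  by apply: cdiff_ext (cdiff_cst 1 z) => w; rewrite big_nil.
by apply: cdiff_ext (cdiffM (df i) IH) => w; rewrite big_cons.
Qed.

End Cdiff.

(** * Mean value estimates and primitives on the real line *)

Section RealCalculus.
Context {R : realType}.
Implicit Types (f g G : R -> R) (a b x y : R).

Lemma is_derive_expand f x l e : is_derive x 1 f l -> 0 < e ->
  exists2 d : R, 0 < d & forall h, `|h| < d -> `|f (x + h) - f x - l * h| <= e * `|h|.
Proof.
move=> /is_derive1_caratheodory [q [Hq qx <-]] e0.
have /qx /= : nbhs (q x) [set y | `|y - q x| < e].
  by apply/nbhs_ballP; exists e => //= w; rewrite -ball_normE /= distrC.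
move=> /nbhs_ballP[d /= d0 Hd]; exists d => // h hd.
rewrite Hq (addrC x) addrK -mulrBl normrM ler_wpM2r //; apply: ltW.
apply: Hd; rewrite -ball_normE /= (_ : _ - _ = - h) ?normrN //; ring.
Qed.

Lemma mvt_le f (df : R -> R) a b hi : a <= b ->
  (forall x, a <= x <= b -> is_derive x 1 f (df x)) ->
  (forall x, a <= x <= b -> df x <= hi) -> f b - f a <= hi * (b - a).
Proof.
move=> ab fd Hd.
have [||c + ->] := @MVT_segment R f df a b ab.
- move=> x; rewrite in_itv /= => /andP[ax xb]; apply: fd; lra.
- apply: derivable_within_continuous => x; rewrite in_itv /= => xab.
  by have [] := fd x xab.
by rewrite in_itv /= => /Hd; apply: ler_wpM2r; rewrite subr_ge0.
Qed.

Lemma mvt_ge f (df : R -> R) a b lo : a <= b ->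
  (forall x, a <= x <= b -> is_derive x 1 f (df x)) ->
  (forall x, a <= x <= b -> lo <= df x) -> lo * (b - a) <= f b - f a.
Proof.
move=> ab fd Hd; rewrite -lerN2 -mulNr.
have := @mvt_le (fun x => - f x) (fun x => - df x) a b (- lo) ab.
rewrite opprK [- f b + _]addrC opprB; apply.
  by move=> x /fd fx; exact: is_deriveN fx.
by move=> x /Hd; rewrite lerN2.
Qed.

(** The mean value theorem for the difference of f and the quadratic polynomial
whose derivative is the affine approximation of df. *)
Lemma mvt_affine f (df : R -> R) a b x (al be et : R) : a <= b ->
  (forall s, a <= s <= b -> is_derive s 1 f (df s)) ->
  (forall s, a <= s <= b -> `|df s - (al + be * (s - x))| <= et) ->
  `|f b - f a - (al * (b - a) + be * ((b - x) ^+ 2 - (a - x) ^+ 2) / 2)|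
    <= et * (b - a).
Proof.
move=> ab fd Hd.
pose P s := al * s + be / 2 * (s - x) ^+ 2.
have Pd (s : R) : is_derive s 1 P (al + be * (s - x)).
  rewrite /P; apply: is_derive_eq; rewrite /GRing.scale /=; by field.
have H1 : forall s, a <= s <= b ->
    is_derive s 1 (fun u : R => f u - P u) (df s - (al + be * (s - x))).
  by move=> t /fd ft; exact: (is_deriveB ft (Pd t)).
have H0 : forall s, a <= s <= b -> - et <= df s - (al + be * (s - x)) <= et.
  by move=> s /Hd; rewrite ler_norml.
have := mvt_le ab H1 (fun s ss => proj2 (andP (H0 s ss))).
have := mvt_ge ab H1 (fun s ss => proj1 (andP (H0 s ss))).
by rewrite ler_norml /P => ? ?; apply/andP; split; lra.
Qed.

(** Composing g with the projection cl onto [a, b] makes it continuous on the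
whole line; the integral is started at a - 1 so that its derivative is two-sided
at the end points. *)
Lemma primitive g a b : a <= b ->
  (forall x, a <= x <= b -> {for x, continuous g}) ->
  exists G, forall x, a <= x <= b -> is_derive x 1 G (g x).
Proof.
move=> ab gc.
pose cl x := Num.max a (Num.min b x).
have cl_in x : a <= cl x <= b.
  by rewrite /cl le_max lexx /= ge_max ab ge_min lexx.
have cl_id x : a <= x <= b -> cl x = x.
  by move=> /andP[ax xb]; rewrite /cl (min_r xb) (max_r ax).
have cl_c : continuous cl.
  move=> x; apply: (@continuous_max _ _ (fun=> a) (fun x => Num.min b x)).
    exact: cvg_cst.
  by apply: (@continuous_min _ _ (fun=> b) id); [exact: cvg_cst|exact: cvg_id].
pose k := g \o cl.
have kc : continuous k.
  by move=> x; apply: continuous_comp; [exact: cl_c|exact/gc/cl_in].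
have ki : lebesgue_measure.-integrable `[a - 1, b + 1] (EFin \o k).
  apply: continuous_compact_integrable; first exact: segment_compact.
  exact: continuous_subspaceT.
exists (fun x0 : R => \int[lebesgue_measure]_(t in `[a - 1, x0]) k t) => x xab.
have [| |H1 H2] := @continuous_FTC1_closed R k (a - 1) x (b + 1) _ ki _ (kc x).
- by move/andP: xab => [_ ?]; rewrite ltr_pwDr.
- by move/andP: xab => [? _]; rewrite ltrBlDr ltr_pwDr.
apply: DeriveDef => //; first by rewrite -derive1E H2 /k /= cl_id.
Qed.

End RealCalculus.

(** * Goursat's theorem on rectangles *)

Section Goursat.
Context {R : realType}.
Implicit Types (a c h k s t e : R) (F : R[i] -> R[i]) (A B : R -> R -> R).

(** When A has derivative P in its first variable and B has derivative Q in its
second one, this is the integral of P ds + Q dt along the boundary of the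
rectangle with corner (a, c) and sides h, k. *)
Definition contour A B a c h k : R :=
  (A (a + h) c - A a c) + (B (a + h) (c + k) - B (a + h) c)
  - (A (a + h) (c + k) - A a (c + k)) - (B a (c + k) - B a c).

Lemma contour_split A B a c h k :
  contour A B a c (h + h) (k + k) =
    contour A B a c h k + contour A B (a + h) c h k +
    contour A B a (c + k) h k + contour A B (a + h) (c + k) h k.
Proof. by rewrite /contour !addrA; ring. Qed.

Variables (F : R[i] -> R[i]) (A B : R -> R -> R) (a0 c0 h0 k0 : R).
Hypothesis h0_ge0 : 0 <= h0.
Hypothesis k0_ge0 : 0 <= k0.
Local Notation inside s t := (a0 <= s <= a0 + h0 /\ c0 <= t <= c0 + k0).
Hypothesis Fd : forall s t, inside s t -> cdiff F (s +i* t).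
Hypothesis Ad : forall s t, inside s t ->
  is_derive s 1 (A^~ t) (Im (F (s +i* t))).
Hypothesis Bd : forall s t, inside s t -> is_derive t 1 (B s) (Re (F (s +i* t))).

(** The form Im F ds + Re F dt is Im (F dz), and an affine holomorphic function has
zero contour integral; only the error of the affine approximation of F
contributes. *)
Lemma contour_local s t e : inside s t -> 0 < e ->
  exists2 d, 0 < d & forall a c h k, 0 <= h -> 0 <= k -> h + k < d ->
    a <= s <= a + h -> c <= t <= c + k ->
    inside a c -> inside (a + h) (c + k) ->
    `|contour A B a c h k| <= e * (h + k) ^+ 2.
Proof.
move=> st e0; have [q qc Fq] := Fd st.
have /ccontP/(_ (e / 2))[|d d0 Hd] := qc; first by rewrite divr_gt0.
exists d => // a c h k h_ge0 k_ge0 hkd /andP[as_ sa] /andP[ct tc].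
move=> [/andP[a1 a2] /andP[c1 c2]] [/andP[a3 a4] /andP[c3 c4]].
set z := s +i* t in qc Fq Hd.
set U0 := Re (F z); set V0 := Im (F z).
set l1 := Re (q z); set l2 := Im (q z).
pose et := e / 2 * (h + k).
have near x y : a <= x <= a + h -> c <= y <= c + k ->
   `|Re (F (x +i* y)) - (U0 + l1 * (x - s) - l2 * (y - t))| <= et /\
   `|Im (F (x +i* y)) - (V0 + l2 * (x - s) + l1 * (y - t))| <= et.
  move=> /andP[ax xa] /andP[cy yc]; set w := x +i* y.
  have wz : nc (w - z) <= h + k.
    apply: le_trans (ler_nc_ReIm _) _; rewrite /= lerD // ler_norml; lra.
  have qw : nc ((q w - q z) * (w - z)) <= et.
    rewrite ncM ler_pM ?nc_ge0 //; apply/ltW/Hd; exact: le_lt_trans hkd.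
  have rD : Re (w - z) = x - s by [].
  have iD : Im (w - z) = y - t by [].
  split.
    apply: le_trans (le_trans (ler_Re_nc _) qw).
    rewrite Fq mulrBl ReD ReB [Re (q z * _)]ReM rD iD -/l1 -/l2 -/U0.
    by rewrite le_eqVlt; apply/orP; left; apply/eqP; congr (`| _ |); ring.
  apply: le_trans (le_trans (ler_Im_nc _) qw).
  rewrite Fq mulrBl ImD ImB [Im (q z * _)]ImM rD iD -/l1 -/l2 -/V0.
  by rewrite le_eqVlt; apply/orP; left; apply/eqP; congr (`| _ |); ring.
have HA y : c <= y <= c + k -> `|A (a + h) y - A a y -
    ((V0 + l1 * (y - t)) * h + l2 * ((a + h - s) ^+ 2 - (a - s) ^+ 2) / 2)| <= et * h.
  move=> cy.
  have := @mvt_affine _ (A^~ y) (fun x => Im (F (x +i* y))) a (a + h) s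
    (V0 + l1 * (y - t)) l2 et.
  rewrite (_ : a + h - a = h); last by ring.
  apply; first by rewrite lerDl.
    move=> x /andP[x1 x2]; apply: Ad; move/andP: cy => [? ?]; split; lra.
  move=> x x12; have [_ H] := near x y x12 cy.
  rewrite (addrAC V0) in H; exact: H.
have HB x : a <= x <= a + h -> `|B x (c + k) - B x c -
    ((U0 + l1 * (x - s)) * k + - l2 * ((c + k - t) ^+ 2 - (c - t) ^+ 2) / 2)| <= et * k.
  move=> ax.
  have := @mvt_affine _ (B x) (fun y => Re (F (x +i* y))) c (c + k) t
    (U0 + l1 * (x - s)) (- l2) et.
  rewrite (_ : c + k - c = k); last by ring.
  apply; first by rewrite lerDl.
    move=> y /andP[y1 y2]; apply: Bd; move/andP: ax => [? ?]; split; lra.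
  move=> y y12; have [H _] := near x y ax y12.
  by rewrite mulNr.
have H1 : a <= a <= a + h by rewrite lexx lerDl.
have H2 : a <= a + h <= a + h by rewrite lexx lerDl h_ge0.
have H3 : c <= c <= c + k by rewrite lexx lerDl.
have H4 : c <= c + k <= c + k by rewrite lexx lerDl k_ge0.
have := HA _ H3; have := HA _ H4; have := HB _ H1; have := HB _ H2.
rewrite !ler_norml /contour /et => /andP[? ?] /andP[? ?] /andP[? ?] /andP[? ?].
apply/andP; split; lra.
Qed.


(** Successive quarters of the rectangle with the property P shrink to a point. *)
Lemma bisection (P : nat -> R -> R -> Prop) :
  P 0%N a0 c0 ->
  (forall n a c, P n a c -> exists a' c', [/\ P n.+1 a' c',
     a <= a' <= a + h0 / 2 ^+ n.+1 & c <= c' <= c + k0 / 2 ^+ n.+1]) ->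
  exists s t, inside s t /\ forall n, exists a c,
    [/\ P n a c, a <= s <= a + h0 / 2 ^+ n, c <= t <= c + k0 / 2 ^+ n,
      inside a c & inside (a + h0 / 2 ^+ n) (c + k0 / 2 ^+ n)].
Proof.
move=> P0 PS.
have step (x : nat * (R * R)) : exists y : R * R, P x.1 x.2.1 x.2.2 ->
    [/\ P x.1.+1 y.1 y.2, x.2.1 <= y.1 <= x.2.1 + h0 / 2 ^+ x.1.+1
      & x.2.2 <= y.2 <= x.2.2 + k0 / 2 ^+ x.1.+1].
  case: x => n [a c] /=; have [/PS[a' [c' H]]|nP] := pselect (P n a c).
    by exists (a', c').
  by exists (a, c).
have [g Hg] := choice step.
pose u := fix u n := if n is m.+1 then g (m, u m) else (a0, c0).
have uP n : P n (u n).1 (u n).2.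
  by elim: n => //= n IH; have [] := Hg (n, u n) IH.
have half (x : R) n : x / 2 ^+ n = x / 2 ^+ n.+1 + x / 2 ^+ n.+1.
  by rewrite exprS; field; rewrite expf_neq0.
have pos (x : R) n : 0 <= x -> 0 <= x / 2 ^+ n.
  by move=> x0; rewrite divr_ge0 ?exprn_ge0.
(* a coordinate of the corners and the length of the matching side: the
   intervals are nested, so the supremum of the left ends is in all of them *)
have nest (v : nat -> R) (l : R) : 0 <= l ->
    (forall n, v n <= v n.+1 <= v n + l / 2 ^+ n.+1) ->
    exists s, forall n, v 0%N <= v n /\ v n + l / 2 ^+ n <= v 0%N + l /\
      v n <= s <= v n + l / 2 ^+ n.
  move=> l0 Hv.
  have mono : {homo v : m n / (m <= n)%N >-> m <= n}.
    apply: homo_leq => //; first exact: le_trans.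
    by move=> n; have /andP[] := Hv n.
  have anti : {homo (fun n => v n + l / 2 ^+ n) : m n / (m <= n)%N >-> n <= m}.
    apply: homo_leq => //; first by move=> y x z xy yz; exact: le_trans yz xy.
    by move=> n; have /andP[_] := Hv n; rewrite (half l n); lra.
  have ub m n : v m <= v n + l / 2 ^+ n.
    have [mn|/ltnW nm] := leqP m n.
      by apply: le_trans (mono _ _ mn) _; rewrite lerDl pos.
    by apply: le_trans (anti _ _ nm); rewrite lerDl pos.
  exists (sup (range v)) => n; split; first exact: mono.
  split; first by have := anti 0%N n (leq0n _); rewrite expr0 divr1.
  apply/andP; split.
    apply: ub_le_sup; last by exists n.
    by exists (v 0%N + l / 2 ^+ 0) => _ [m _ <-]; exact: ub.
  by apply: ge_sup; [exists (v 0%N); exists 0%N|move=> _ [m _ <-]; exact: ub].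
have [n|s Hs] := nest (fun n => (u n).1) h0 h0_ge0.
  by have [] := Hg (n, u n) (uP n).
have [n|t Ht] := nest (fun n => (u n).2) k0 k0_ge0.
  by have [] := Hg (n, u n) (uP n).
exists s, t; split.
  by have [_ [_]] := Hs 0%N; have [_ [_]] := Ht 0%N; rewrite !expr0 !divr1.
move=> n; exists (u n).1, (u n).2.
have [/= ? [? ?]] := Hs n; have [/= ? [? ?]] := Ht n.
have := pos h0 n h0_ge0; have := pos k0 n k0_ge0 => ? ?.
split => //; split; lra.
Qed.

(** Goursat's theorem.  If the contour integral exceeded a multiple e of the
squared half-perimeter, so would that of a quarter, and successive quarters would
contradict contour_local at their common point. *)
Lemma goursat : contour A B a0 c0 h0 k0 = 0.
Proof.
apply/eqP; rewrite -normr_le0; apply/ler_addgt0Pr => e' e'0; rewrite add0r.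
pose D := h0 + k0.
pose e := e' / (1 + D ^+ 2).
have e0 : 0 < e by rewrite divr_gt0 // ltr_wpDr ?sqr_ge0.
suff : `|contour A B a0 c0 h0 k0| <= e * D ^+ 2.
  move=> /le_trans; apply; rewrite /e mulrAC ler_pdivrMr ?ltr_wpDr ?sqr_ge0 //.
  by rewrite ler_wpM2l ?lerDr ?ler01 // ltW.
rewrite leNgt; apply/negP => bad.
pose P n a c := e * (D / 2 ^+ n) ^+ 2 <
  `|contour A B a c (h0 / 2 ^+ n) (k0 / 2 ^+ n)|.
have half (x : R) n : x / 2 ^+ n = x / 2 ^+ n.+1 + x / 2 ^+ n.+1.
  by rewrite exprS; field; rewrite expf_neq0.
have [| |s [t [st H]]] := @bisection P.
- by rewrite /P !expr0 !divr1.
- move=> n a c; rewrite /P (half h0) (half k0) contour_split (half D).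
  set h := h0 / _; set k := k0 / _; set d := D / _ => big.
  have hp : 0 <= h by rewrite divr_ge0 ?exprn_ge0.
  have kp : 0 <= k by rewrite divr_ge0 ?exprn_ge0.
  have [b1|b1] := ltP (e * d ^+ 2) `|contour A B a c h k|.
    by exists a, c; split=> //; lra.
  have [b2|b2] := ltP (e * d ^+ 2) `|contour A B (a + h) c h k|.
    by exists (a + h), c; split=> //; lra.
  have [b3|b3] := ltP (e * d ^+ 2) `|contour A B a (c + k) h k|.
    by exists a, (c + k); split=> //; lra.
  have [b4|b4] := ltP (e * d ^+ 2) `|contour A B (a + h) (c + k) h k|.
    by exists (a + h), (c + k); split=> //; lra.
  exfalso; move: big; apply/negP; rewrite -leNgt.
  rewrite (_ : e * (d + d) ^+ 2 = e * d ^+ 2 + e * d ^+ 2 + e * d ^+ 2 + e * d ^+ 2).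
    apply: le_trans (ler_normD _ _) (lerD _ b4).
    apply: le_trans (ler_normD _ _) (lerD _ b3).
    by apply: le_trans (ler_normD _ _) (lerD b1 b2).
  by ring.
have [d d0 Hd] := contour_local st e0.
have [n nd] : exists n, D / 2 ^+ n < d.
  have Dd : 0 <= D / d by rewrite divr_ge0 ?addr_ge0 // ltW.
  exists (Num.bound (D / d)).
  rewrite ltr_pdivrMr ?exprn_gt0 // mulrC -ltr_pdivrMr //.
  by rewrite (lt_trans (archi_boundP Dd)) // -natrX ltr_nat ltn_expl.
have [a [c [Pn as_ ct i1 i2]]] := H n.
move: Pn; rewrite /P; apply/negP; rewrite -leNgt.
have -> : D / 2 ^+ n = h0 / 2 ^+ n + k0 / 2 ^+ n by rewrite /D mulrDl.
apply: Hd => //; rewrite ?divr_ge0 ?exprn_ge0 //.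
by rewrite -mulrDl.
Qed.
End Goursat.

(** * The mean value inequality *)

Section MeanValue.
Context {R : realType}.
Implicit Types (z w : R[i]).

Definition cexp z : R[i] :=
  (expR (Re z) * cos (Im z)) +i* (expR (Re z) * sin (Im z)).

Lemma cexpD z w : cexp (z + w) = cexp z * cexp w.
Proof.
by apply: complex_eqP; rewrite ?ReM ?ImM /= ReD ImD expRD ?cosD ?sinD; ring.
Qed.

Lemma cexp0 : cexp 0 = 1.
Proof. by rewrite /cexp /= expR0 cos0 sin0 mulr0 mulr1. Qed.

Lemma nc_cexp z : nc (cexp z) = expR (Re z).
Proof.
apply/eqP; rewrite -(@eqrXn2 _ 2) ?nc_ge0 ?expR_ge0 // sqr_nc /=.
by rewrite !exprMn -mulrDr cos2Dsin2 mulr1.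
Qed.

Lemma cexp_near0 (e : R) : 0 < e -> exists2 d : R, 0 < d & forall w, nc w < d ->
  nc (cexp w - 1 - w) <= e * nc w.
Proof.
move=> e0; (* the errors of exp, cos and sin add up to at most 9 e1 |w| *)
pose e1 := Num.min 1 (e / 9).
have e1_gt0 : 0 < e1 by rewrite lt_min ltr01 divr_gt0.
have e1_le1 : e1 <= 1 by rewrite ge_min lexx.
have e1_le : 9 * e1 <= e.
  have : e1 <= e / 9 by rewrite ge_min lexx orbT.
  lra.
clearbody e1.
have [d1 d1_gt0 H1] := is_derive_expand (is_derive_expR (0 : R)) e1_gt0.
have [d2 d2_gt0 H2] := is_derive_expand (is_derive_cos (0 : R)) e1_gt0.
have [d3 d3_gt0 H3] := is_derive_expand (is_derive_sin (0 : R)) e1_gt0.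
exists (Num.min (Num.min d1 d2) (Num.min d3 e1)); first by rewrite !lt_min d1_gt0 d2_gt0 d3_gt0 e1_gt0.
move=> w; set h := Re w; set k := Im w; set n := nc w.
have hn : `|h| <= n := ler_Re_nc w; have kn : `|k| <= n := ler_Im_nc w.
rewrite !lt_min => /andP[/andP[nd1 nd2] /andP[nd3 ne1]].
have := H1 h (le_lt_trans hn nd1); have := H2 k (le_lt_trans kn nd2).
have := H3 k (le_lt_trans kn nd3).
rewrite !add0r expR0 cos0 sin0 oppr0 mul0r !mul1r ?subr0 ?addr0 => Hs Hc He.
have E1 : `|expR h - 1| <= 2 * e1.
  have -> : expR h - 1 = (expR h - 1 - h) + h by rewrite subrK.
  apply: le_trans (ler_normD _ _) _.
  have : e1 * `|h| <= 1 * `|h| by rewrite ler_wpM2r.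
  lra.
have E2 : `|expR h| <= 3.
  have -> : expR h = (expR h - 1) + 1 by rewrite subrK.
  apply: le_trans (ler_normD _ _) _; rewrite normr1; lra.
apply: le_trans (ler_nc_ReIm _) _; rewrite !ReImE /= -/h -/k.
have -> : expR h * cos k - 1 - h = (expR h - 1 - h) + expR h * (cos k - 1) by ring.
have -> : expR h * sin k - 0 - k = expR h * (sin k - k) + (expR h - 1) * k by ring.
have P1 := ler_normD (expR h - 1 - h) (expR h * (cos k - 1)).
have P2 := ler_normD (expR h * (sin k - k)) ((expR h - 1) * k).
rewrite !normrM in P1 P2.
have Q1 : `|expR h| * `|cos k - 1| <= 3 * (e1 * `|k|) by rewrite ler_pM.
have Q2 : `|expR h| * `|sin k - k| <= 3 * (e1 * `|k|) by rewrite ler_pM.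
have Q3 : `|expR h - 1| * `|k| <= 2 * e1 * `|k| by rewrite ler_wpM2r.
have Q4 : e1 * `|h| <= e1 * n by rewrite ler_wpM2l // ltW.
have Q5 : e1 * `|k| <= e1 * n by rewrite ler_wpM2l // ltW.
have Q6 : 9 * e1 * n <= e * n by rewrite ler_wpM2r // nc_ge0.
lra.
Qed.

Lemma cdiff_cexp z : cdiff cexp z.
Proof.
have d0 : cdiff cexp 0.
  exists (fun w => if w == 0 then 1 else (cexp w - 1) / w); last first.
    move=> w; rewrite cexp0 subr0; case: eqP => [->|/eqP w0].
      by rewrite cexp0 mulr0 addr0.
    by rewrite divfK // addrC subrK.
  apply/ccontP => e e0; have [d d_gt0 Hd] := cexp_near0 (divr_gt0 e0 (ltr0Sn _ 1)).
  exists d => // w; rewrite subr0 eqxx => /Hd Hw; case: eqP => [_|/eqP w0].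
    by rewrite subrr nc0.
  have -> : (cexp w - 1) / w - 1 = (cexp w - 1 - w) / w by field.
  rewrite ncM ncV ltr_pdivrMr ?nc_gt0 //; apply: le_lt_trans Hw _.
  by rewrite ltr_pM2r ?nc_gt0 //; lra.
apply: (@cdiff_ext _ (fun w => cexp z * cexp (w - z))).
  by move=> w; rewrite -cexpD addrC subrK.
apply: cdiffM (cdiff_cst _ _) _.
apply: (@cdiff_comp _ (fun w => w - z) cexp); last by rewrite subrr.
exact: cdiffB (cdiff_id _) (cdiff_cst _ _).
Qed.

Lemma cont_path (g : R[i] -> R) (p : R -> R[i]) (s : R) :
  (forall x, nc (p x - p s) <= `|x - s|) ->
  {for p s, continuous (g : R[i]^o -> R)} -> {for s, continuous (fun x => g (p x))}.
Proof.
move=> Hp /rcontP Hg B /nbhs_ballP[e /= e0 HB]; have [d d0 Hd] := Hg e e0.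
apply/nbhs_ballP; exists d => //= x; rewrite -ball_normE /= distrC => xd.
apply: HB; rewrite -ball_normE /= distrC; apply: Hd; exact: le_lt_trans xd.
Qed.

(** The mean of Re f over the circle is its value at the centre.  In the
coordinates z0 + r exp (s + i t) the circle is the right side of a rectangle
of height 2 pi whose horizontal sides agree by periodicity and whose left side
shrinks to z0; Goursat's theorem equates the integrals of Re f along the two
vertical sides. *)
Lemma Re_le_circle (f : R[i] -> R[i]) z0 (r m : R) : 0 < r ->
  (forall w, nc (w - z0) <= r -> cdiff f w) ->
  (forall w, nc (w - z0) = r -> Re (f w) <= m) -> Re (f z0) <= m.
Proof.
move=> r0 fd fm; apply/ler_addgt0Pr => e e0.
have /ccontP/(_ e e0)[d d0 Hd] : {for z0, continuous (f : R[i]^o -> R[i]^o)}.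
  by apply/cdiff_cont/fd; rewrite subrr nc0 ltW.
pose p z := z0 + r%:C * cexp z.
have pz z : nc (p z - z0) = r * expR (Re z).
  by rewrite /p addrC addKr ncM nc_real gtr0_norm // nc_cexp.
have pd z : cdiff p z.
  apply: cdiffD (cdiff_cst _ _) _; apply: cdiffM (cdiff_cst _ _) _; exact: cdiff_cexp.
pose F z := f (p z).
have Fd (s t : R) : s <= 0 -> cdiff F (s +i* t).
  move=> s0; apply: (@cdiff_comp _ p f) => //; apply: fd; rewrite pz /=.
  by rewrite -[leRHS]mulr1 ler_wpM2l ?(ltW r0) // expR_le1.
set P : R := pi *+ 2.
have P0 : 0 < P by rewrite mulrn_wgt0 // pi_gt0.
(* s1 = - S is so far to the left that r exp s1 < d *)
pose S : R := Num.max 1 (r / d).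
have S1 : 1 <= S by rewrite le_max lexx.
pose s1 : R := - S.
have s1_le0 : s1 <= 0 by rewrite oppr_le0; lra.
have contS (t s : R) : s1 <= s <= 0 -> {for s, continuous (fun s => Im (F (s +i* t)))}.
  move=> /andP[_ /(Fd s t) Fst]; apply: (@cont_path (fun z => Im (F z)) (fun s : R => s +i* t)).
    by move=> x; apply: le_trans (ler_nc_ReIm _) _; rewrite /= subrr normr0 addr0.
  exact: (continuous_comp (cdiff_cont Fst) (@cont_Im R _)).
have contT (s t : R) : s <= 0 -> {for t, continuous (fun t => Re (F (s +i* t)))}.
  move=> /(Fd s t) Fst; apply: (@cont_path (fun z => Re (F z)) (fun t : R => s +i* t)).
    by move=> x; apply: le_trans (ler_nc_ReIm _) _; rewrite /= subrr normr0 add0r.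
  exact: (continuous_comp (cdiff_cont Fst) (@cont_Re R _)).
have [A HA] := choice (fun t => primitive s1_le0 (contS t)).
have primT (s : R) : exists G : R -> R, s1 <= s <= 0 ->
    forall t : R, 0 <= t <= P -> is_derive t 1 G (Re (F (s +i* t))).
  have [s0|] := pselect (s1 <= s <= 0); last by exists (fun=> 0).
  have [G HG] : exists G, forall t : R, 0 <= t <= P ->
      is_derive t 1 G (Re (F (s +i* t))).
    by apply: (primitive (ltW P0)) => t _; apply: contT; case/andP: s0.
  by exists G.
have [B HB] := choice primT.
have per s : F (s +i* P) = F (s +i* 0).
  by rewrite /F /p /cexp /= cos0 sin0 cos2pi sin2pi.
have s1_in : s1 <= s1 <= 0 by rewrite lexx.
have in0 : s1 <= (0 : R) <= 0 by rewrite lexx s1_le0.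
have rI (s : R) : s1 <= s <= s1 + - s1 -> s1 <= s <= 0 by rewrite subrr.
have tI (t : R) : 0 <= t <= 0 + P -> 0 <= t <= P by rewrite add0r.
have W : contour (fun s t => A t s) B s1 0 (- s1) P = 0.
  apply: (@goursat _ F); rewrite ?oppr_ge0 ?(ltW P0) //.
  - by move=> s t [/rI/andP[_ ?] _]; exact: Fd.
  - by move=> s t [/rI ? _]; exact: HA.
  - by move=> s t [/rI ? /tI ?]; exact: HB.
have horiz : A 0 0 - A 0 s1 = A P 0 - A P s1.
  have D0 (s : R) : s1 <= s <= 0 -> is_derive s 1 (fun x => A 0 x - A P x) 0.
    by move=> s10; have := is_deriveB (HA 0 s s10) (HA P s s10); rewrite per subrr.
  have := mvt_le s1_le0 D0 (fun _ _ => lexx 0).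
  have := mvt_ge s1_le0 D0 (fun _ _ => lexx 0).
  by rewrite !mul0r; lra.
have right_ : B 0 P - B 0 0 <= m * P.
  rewrite -[P in leRHS]subr0; apply: mvt_le (HB 0 in0) _; first exact: ltW.
  by move=> t _; apply: fm; rewrite pz /= expR0 mulr1.
have left_ : (Re (f z0) - e) * P <= B s1 P - B s1 0.
  rewrite -[P in leLHS]subr0; apply: mvt_ge (HB s1 s1_in) _; first exact: ltW.
  move=> t _; have : nc (F (s1 +i* t) - f z0) < e.
    apply: Hd; rewrite pz /= /s1 expRN ltr_pdivrMr ?expR_gt0 //.
    rewrite mulrC -ltr_pdivrMr //; apply: lt_le_trans (expR_ge1Dx _).
    have : r / d <= S by rewrite le_max lexx orbT.
    lra.
  by move=> /ltW /(le_trans (ler_Re_nc _)); rewrite ReB ler_norml; lra.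
suff : (Re (f z0) - e) * P <= m * P by rewrite ler_pM2r // lerBlDr.
by move: W; rewrite /contour subrr add0r; lra.
Qed.

End MeanValue.

(** * The maximum principle *)

Section MaximumPrinciple.
Context {R : realType}.
Implicit Types (z w : R[i]).

Lemma continuous_pair_complex :
  continuous ((fun p => p.1 +i* p.2) : R * R -> R[i]^o).
Proof.
move=> p A /nbhs_ncP[d d0 HA]; apply/nbhs_ballP; exists (d / 2).
  by rewrite /= divr_gt0.
move=> q [/= q1 q2]; apply: HA; apply: le_lt_trans (ler_nc_ReIm _) _ => /=.
by move: q1 q2; rewrite -!ball_normE /= distrC [`|p.2 - _|]distrC; lra.
Qed.

(** The superlevel set is compact, as a closed subset of a square of R * R. *)
Lemma superlevel_EVT (g h : R[i] -> R) (K : R) z0 :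
  (forall z, {for z, continuous (g : R[i]^o -> R)}) ->
  (forall z, 0 <= g z -> nc z <= K) ->
  (forall z, 0 <= g z -> {for z, continuous (h : R[i]^o -> R)}) ->
  0 <= g z0 ->
  exists2 z, 0 <= g z & forall w, 0 <= g w -> h w <= h z.
Proof.
move=> gc gK hc gz0.
pose c (p : R * R) : R[i]^o := p.1 +i* p.2.
pose D := [set p : R * R | 0 <= g (c p)].
have Dcl : closed D.
  have -> : D = (g \o c) @^-1` [set x | 0 <= x] by [].
  apply: preimage_closed; last exact: closed_ge.
  move=> p _; apply: (@continuous_comp _ _ _ c (g : R[i]^o -> R)).
    exact: continuous_pair_complex.
  exact: gc.
have Dco : compact D.
  apply: (@subclosed_compact _ _ (`[- K, K] `*` `[- K, K])) => //.
    by apply: compact_setX; exact: segment_compact.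
  move=> p /= /gK cK; rewrite /= !in_itv /= -!ler_norml.
  by split; [apply: le_trans (ler_Re_nc (c p)) cK|apply: le_trans (ler_Im_nc (c p)) cK].
have cK z : c (Re z, Im z) = z by case: z.
have [||p pD Hp] := @compact_EVT_max _ R (h \o c) D _ Dco.
- by exists (Re z0, Im z0); rewrite /D /= cK.
- apply: continuous_in_subspaceT => p; rewrite inE => Dp.
  apply: (@continuous_comp _ _ _ c (h : R[i]^o -> R)).
    exact: continuous_pair_complex.
  exact: hc.
exists (c p); first by move: pD; rewrite inE.
move=> w gw; have := Hp (Re w, Im w); rewrite /= cK; apply.
by rewrite inE /D /= cK.
Qed.

(** At an interior maximum of the perturbed function |f|^2 + delta |z|^2 the
linearization of both squares is a holomorphic function vanishing at the
centre and with real part at most - delta r^2 / 2 on small circles, against the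
mean value property. *)
Lemma maximum_principle (f : R[i] -> R[i]) (g : R[i] -> R) (K M : R) : 0 <= M ->
  (forall z, {for z, continuous (g : R[i]^o -> R)}) ->
  (forall z, 0 <= g z -> nc z <= K) ->
  (forall z, 0 <= g z -> cdiff f z) ->
  (forall z, g z = 0 -> nc (f z) <= M) ->
  forall z, 0 <= g z -> nc (f z) <= M.
Proof.
move=> M0 gc gK fd fM z1 gz1; rewrite leNgt; apply/negP => Mf.
have K0 : 0 <= K := le_trans (nc_ge0 _) (gK _ gz1).
(* delta |z|^2 stays below half of the gap between the values of |f|^2 *)
pose de := (nc (f z1) ^+ 2 - M ^+ 2) / (2 * (K ^+ 2 + 1)).
have Mf2 : M ^+ 2 < nc (f z1) ^+ 2 by rewrite ltrXn2r // ?nc_ge0.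
have de0 : 0 < de by rewrite divr_gt0 ?subr_gt0 // mulr_gt0 // ltr_wpDl // sqr_ge0.
have deK : de * (2 * (K ^+ 2 + 1)) = nc (f z1) ^+ 2 - M ^+ 2.
  by rewrite divfK // gt_eqF // mulr_gt0 // ltr_wpDl // sqr_ge0.
clearbody de.
pose h z := nc (f z) ^+ 2 + de * nc z ^+ 2.
have hc z : 0 <= g z -> {for z, continuous (h : R[i]^o -> R)}.
  move=> gz; have sqc : continuous (fun x : R => x ^+ 2) by exact: exprn_continuous.
  have dsqc : continuous (fun x : R => de * x ^+ 2).
    by move=> x; exact: (continuous_comp (sqc x) (@mulrl_continuous _ _ _)).
  have c1 := continuous_comp (cdiff_cont (fd _ gz)) (@cont_nc R _).
  exact: (cvgD (continuous_comp c1 (sqc _)) (continuous_comp (@cont_nc R z) (dsqc _))).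
have [z gz Hz] := superlevel_EVT gc gK hc gz1.
have big : nc (f z1) ^+ 2 <= h z.
  by apply: le_trans (Hz _ gz1); rewrite lerDl mulr_ge0 ?sqr_ge0 // ltW.
have zK : nc z ^+ 2 <= K ^+ 2 by rewrite lerXn2r ?nnegrE ?nc_ge0 ?gK.
have gz_gt0 : 0 < g z.
  rewrite lt_neqAle gz andbT; apply/eqP => /esym/fM fzM.
  have : nc (f z) ^+ 2 <= M ^+ 2.
    by rewrite lerXn2r ?nnegrE ?nc_ge0.
  have : de * nc z ^+ 2 <= de * K ^+ 2 by rewrite ler_wpM2l // ltW.
  have : 0 <= de * K ^+ 2 by rewrite mulr_ge0 ?sqr_ge0 // ltW.
  by move: big deK; rewrite /h; lra.
have /rcontP/(_ _ gz_gt0)[d d0 Hd] := gc z.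
pose r := d / 2; have r0 : 0 < r by rewrite divr_gt0.
have ball w : nc (w - z) <= r -> 0 <= g w.
  move=> wr; have : nc (w - z) < d by apply: le_lt_trans wr _; rewrite /r; lra.
  by move=> /Hd; rewrite ltr_norml; lra.
pose G w := conjc (f z) * (f w - f z) + de%:C * conjc z * (w - z).
have := @Re_le_circle _ G z r (- (de * r ^+ 2 / 2)) r0.
have -> : Re (G z) = 0 by rewrite /G !subrr !mulr0 addr0.
have dr : 0 < de * r ^+ 2 by rewrite mulr_gt0 // exprn_gt0.
suff H : forall w, nc (w - z) = r -> Re (G w) <= - (de * r ^+ 2 / 2).
  move=> /(_ _ H) => HH.
  have : 0 <= - (de * r ^+ 2 / 2).
    apply: HH => w /ball /fd fw; apply: cdiffD; apply: cdiffM.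
    - exact: cdiff_cst.
    - exact: cdiffB fw (cdiff_cst _ _).
    - exact: cdiff_cst.
    - exact: cdiffB (cdiff_id _) (cdiff_cst _ _).
  by lra.
move=> w wr; have /Hz : 0 <= g w by apply: ball; rewrite wr.
have rE : r ^+ 2 = nc (w - z) ^+ 2 by rewrite wr.
have : 0 <= nc (f w - f z) ^+ 2 by rewrite sqr_ge0.
rewrite /h /G rE !sqr_nc !ReImE /=.
move: (Re (f w)) (Im (f w)) (Re (f z)) (Im (f z)) (Re w) (Im w) (Re z) (Im z).
move=> a b c e x y u v; lra.
Qed.

Lemma continuous_minr (g1 g2 : R[i] -> R) :
  (forall z, {for z, continuous (g1 : R[i]^o -> R)}) ->
  (forall z, {for z, continuous (g2 : R[i]^o -> R)}) ->
  forall z, {for z, continuous ((fun w => Num.min (g1 w) (g2 w)) : R[i]^o -> R)}.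
Proof. by move=> c1 c2 z; exact: (continuous_min (c1 z) (c2 z)). Qed.

(** On an unbounded region the bound on the boundary must be supplemented by the
same bound at infinity. *)
Lemma maximum_principle_infinity (f : R[i] -> R[i]) (g : R[i] -> R) (M : R) :
  0 <= M ->
  (forall z, {for z, continuous (g : R[i]^o -> R)}) ->
  (forall z, 0 <= g z -> cdiff f z) ->
  (forall z, g z = 0 -> nc (f z) <= M) ->
  (forall e, 0 < e -> exists K : R, forall z, 0 <= g z -> K <= nc z ->
     nc (f z) <= M + e) ->
  forall z, 0 <= g z -> nc (f z) <= M.
Proof.
move=> M0 gc fd fM finf z gz; apply/ler_addgt0Pr => e e0.
have [K0 HK0] := finf e e0; pose K := Num.max K0 (nc z).
apply: (@maximum_principle f (fun w => Num.min (g w) (K - nc w)) K) => //.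
- by rewrite addr_ge0 // ltW.
- apply: continuous_minr => // w.
  have c : continuous (fun x : R => K - x).
    by move=> x; exact: (cvgB (@cvg_cst _ K _ _ _) cvg_id).
  exact: (continuous_comp (@cont_nc R w) (c _)).
- by move=> w; rewrite le_min subr_ge0 => /andP[].
- by move=> w; rewrite le_min => /andP[/fd].
- move=> w; have [H|H] := leP (g w) (K - nc w).
    by move=> /fM /le_trans; apply; rewrite lerDl ltW.
  move=> /eqP; rewrite subr_eq0 => /eqP KE; apply: HK0.
    by apply: ltW; rewrite (le_lt_trans _ H) // -KE subrr.
  by rewrite -KE le_max lexx.
by rewrite le_min gz subr_ge0 le_max lexx orbT.
Qed.
End MaximumPrinciple.

(** * Finite Blaschke products *)

Section Blaschke.
Context {R : realType}.
Implicit Types (a z w : R[i]) (s : seq (R[i] * nat)).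

Definition bfactor a z : R[i] := (z - a) / (z - conjc a).

Definition blaschke s z : R[i] := \prod_(p <- s) bfactor p.1 z ^+ p.2.

(** 1 - |bfactor a z|^2, by sqr_nc_bfactor. *)
Definition bdefect a z : R := 4 * Im z * Im a / nc (z - conjc a) ^+ 2.

Definition bmass s z : R := \sum_(p <- s) p.2%:R * bdefect p.1 z.

Definition in_uhp s := forall p, p \in s -> 0 < Im p.1.

Lemma in_uhp_cons p s : in_uhp (p :: s) -> 0 < Im p.1 /\ in_uhp s.
Proof.
move=> H; split; first by apply: H; rewrite inE eqxx.
by move=> q qs; apply: H; rewrite inE qs orbT.
Qed.

Lemma sub_conj_neq0 a z : 0 < Im a -> 0 <= Im z -> z - conjc a != 0.
Proof.
move=> a0 z0; apply/eqP => /(congr1 (@Im R)) /=; rewrite !ReImE /=; lra.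
Qed.

Lemma nc_sub_conj_gt0 a z : 0 < Im a -> 0 <= Im z -> 0 < nc (z - conjc a).
Proof. by move=> a0 z0; rewrite nc_gt0 sub_conj_neq0. Qed.

Lemma sqr_nc_bfactor a z : 0 < Im a -> 0 <= Im z ->
  nc (bfactor a z) ^+ 2 = 1 - bdefect a z.
Proof.
move=> a0 z0; have := nc_sub_conj_gt0 a0 z0.
rewrite /bfactor /bdefect ncM ncV exprMn exprVn => d0.
have -> : nc (z - a) ^+ 2 = nc (z - conjc a) ^+ 2 - 4 * Im z * Im a.
  rewrite !sqr_nc !ReImE; ring.
by field; rewrite gt_eqF.
Qed.

Lemma bdefect_ge0 a z : 0 < Im a -> 0 <= Im z -> 0 <= bdefect a z.
Proof. by move=> a0 z0; rewrite /bdefect divr_ge0 ?sqr_ge0 ?mulr_ge0 // ltW. Qed.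

Lemma bdefect_le1 a z : 0 < Im a -> 0 <= Im z -> bdefect a z <= 1.
Proof. by move=> a0 z0; rewrite -subr_ge0 -sqr_nc_bfactor // sqr_ge0. Qed.

Lemma blaschke_nil z : blaschke [::] z = 1.
Proof. by rewrite /blaschke big_nil. Qed.

Lemma blaschke_cons p s z : blaschke (p :: s) z = bfactor p.1 z ^+ p.2 * blaschke s z.
Proof. by rewrite /blaschke big_cons. Qed.

Lemma bmass_cons p s z : bmass (p :: s) z = p.2%:R * bdefect p.1 z + bmass s z.
Proof. by rewrite /bmass big_cons. Qed.

Lemma blaschke_le1 s z : in_uhp s -> 0 <= Im z -> nc (blaschke s z) <= 1.
Proof.
move=> Hs z0; elim: s Hs => [|p s IH] Hs; first by rewrite blaschke_nil nc1.
have [p0 s0] := in_uhp_cons Hs.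
rewrite blaschke_cons ncM ncX mulr_ile1 ?nc_ge0 ?exprn_ge0 ?IH ?nc_ge0 //.
rewrite exprn_ile1 ?nc_ge0 // -(@expr_le1 _ 2) ?nc_ge0 //.
by rewrite sqr_nc_bfactor // gerBl bdefect_ge0.
Qed.

Lemma bernoulli_pow (t : R) n : 0 <= t <= 1 -> 1 - n%:R * t <= (1 - t) ^+ n.
Proof.
move=> /andP[t0 t1]; elim: n => [|n IH]; first by rewrite mul0r subr0 expr0.
rewrite exprSr -natr1; have : (1 - t) ^+ n <= 1 by rewrite exprn_ile1; lra.
move=> H; have : t * (1 - t) ^+ n <= t by rewrite -[leRHS]mulr1 ler_wpM2l.
lra.
Qed.

(** The product of the numbers 1 - t with 0 <= t <= 1 is at least 1 minus the sum
of the t. *)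
Lemma blaschke_ge s z : in_uhp s -> 0 <= Im z ->
  1 - bmass s z <= nc (blaschke s z) ^+ 2.
Proof.
move=> Hs z0; elim: s Hs => [|p s IH] Hs.
  by rewrite blaschke_nil nc1 expr1n /bmass big_nil subr0.
have [p0 s0] := in_uhp_cons Hs; have {IH} := IH s0.
rewrite blaschke_cons bmass_cons ncM ncX exprMn exprAC sqr_nc_bfactor //.
have := @bernoulli_pow (bdefect p.1 z) p.2; rewrite bdefect_ge0 ?bdefect_le1 // => /(_ isT).
have : (1 - bdefect p.1 z) ^+ p.2 <= 1.
  by rewrite exprn_ile1 ?gerBl ?subr_ge0 ?bdefect_ge0 ?bdefect_le1.
have : nc (blaschke s z) ^+ 2 <= 1 by rewrite exprn_ile1 ?nc_ge0 ?blaschke_le1.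
have : 0 <= nc (blaschke s z) ^+ 2 by rewrite sqr_ge0.
move: (_ ^+ p.2) (nc _ ^+ 2) (_ * bdefect _ _) (bmass s z) => x y u v y0 y1 x1 xu yv.
have : 0 <= (1 - x) * (1 - y) by rewrite mulr_ge0 // subr_ge0.
lra.
Qed.

Lemma blaschke_le_exp s z : in_uhp s -> 0 <= Im z ->
  nc (blaschke s z) ^+ 2 <= expR (- bmass s z).
Proof.
move=> Hs z0; elim: s Hs => [|p s IH] Hs.
  by rewrite blaschke_nil nc1 expr1n /bmass big_nil oppr0 expR0.
have [p0 s0] := in_uhp_cons Hs; have {}IH := IH s0.
rewrite blaschke_cons bmass_cons ncM ncX exprMn opprD expRD ler_pM ?sqr_ge0 //.
rewrite exprAC sqr_nc_bfactor // -[- (p.2%:R * _)]mulrN expRM_natl.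
rewrite lerXn2r ?nnegrE ?expR_ge0 ?subr_ge0 ?bdefect_le1 //.
exact: expR_ge1Dx.
Qed.

Lemma blaschke_real s (x : R) : in_uhp s -> nc (blaschke s x%:C) = 1.
Proof.
move=> Hs; elim: s Hs => [|p s IH] Hs; first by rewrite blaschke_nil nc1.
have [p0 s0] := in_uhp_cons Hs.
rewrite blaschke_cons ncM ncX IH // mulr1.
apply/eqP; rewrite -(@eqrXn2 _ 2) ?exprn_ge0 ?nc_ge0 // exprAC sqr_nc_bfactor //.
by rewrite /bdefect /= mulr0 !mul0r subr0 !expr1n.
Qed.

(** bmass s z is at most C / |z| for large |z|, since Im z <= |z| while the
distance of z to the zeros is comparable to |z|. *)
Lemma blaschke_infinity s (e : R) : in_uhp s -> 0 < e ->
  exists K : R, forall z, 0 <= Im z -> K <= nc z -> 1 <= (1 + e) * nc (blaschke s z).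
Proof.
move=> Hs e0.
have [C C0 HC] : exists2 C : R, 0 <= C & forall z, 0 <= Im z -> C < nc z ->
    bmass s z <= C / nc z.
  elim: s Hs => [|p s IH] Hs.
    by exists 0 => // z _ _; rewrite /bmass big_nil mul0r.
  have [p0 s0] := in_uhp_cons Hs; have [C C0 HC] := IH s0.
  have P0 : 0 <= p.2%:R * (16 * Im p.1) by rewrite !mulr_ge0 // ltW.
  have Q0 : 0 <= 2 * nc p.1 by rewrite mulr_ge0 // nc_ge0.
  exists (p.2%:R * (16 * Im p.1) + C + 2 * nc p.1); first by rewrite !addr_ge0.
  move=> z z0 zl.
  have zC : C < nc z by lra.
  have zp : 0 < nc z by lra.
  rewrite bmass_cons -addrA mulrDl lerD //; last first.
    apply: le_trans (HC z z0 zC) _.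
    by rewrite ler_wpM2r ?invr_ge0 ?nc_ge0 // lerDl.
  rewrite -mulrA ler_wpM2l // /bdefect.
  have far : nc z / 2 <= nc (z - conjc p.1).
    by have := ler_dist_nc z (conjc p.1); rewrite nc_conj ler_norml; lra.
  have far2 : (nc z / 2) ^+ 2 <= nc (z - conjc p.1) ^+ 2.
    by rewrite lerXn2r ?nnegrE ?nc_ge0 // divr_ge0 ?nc_ge0.
  have zi : Im z <= nc z := le_trans (ler_norm _) (ler_Im_nc z).
  rewrite ler_pdivrMr; last by apply: lt_le_trans far2; rewrite exprn_gt0 // divr_gt0.
  apply: le_trans (_ : 16 * Im p.1 / nc z * (nc z / 2) ^+ 2 <= _); last first.
    by rewrite ler_wpM2l // !mulr_ge0 ?invr_ge0 ?nc_ge0 // ltW.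
  have -> : 16 * Im p.1 / nc z * (nc z / 2) ^+ 2 = 4 * nc z * Im p.1.
    by field; rewrite gt_eqF.
  by rewrite ler_wpM2r ?(ltW p0) // ler_wpM2l.
exists (C * (1 + e) / e + C + 1) => z z0 zl.
have Ce : 0 <= C * (1 + e) / e by rewrite divr_ge0 ?mulr_ge0 //; lra.
have zC : C < nc z by lra.
have zp : 0 < nc z by lra.
have H1 := HC z z0 zC; have H2 := blaschke_ge Hs z0.
have : nc (blaschke s z) ^+ 2 <= nc (blaschke s z).
  by rewrite expr2 -[leRHS]mulr1 ler_wpM2l ?nc_ge0 // blaschke_le1.
have : C / nc z <= e / (1 + e).
  rewrite ler_pdivrMr // mulrAC ler_pdivlMr; last by lra.
  by rewrite mulrC -ler_pdivrMl // mulrC; lra.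
move=> H3 H4.
have : e / (1 + e) * (1 + e) = e by rewrite divfK // gt_eqF; lra.
have : (1 + e) * (1 - e / (1 + e)) <= (1 + e) * nc (blaschke s z).
  by rewrite ler_wpM2l; lra.
lra.
Qed.

Lemma cdiff_bfactor a z : 0 < Im a -> 0 <= Im z -> cdiff (bfactor a) z.
Proof.
move=> a0 z0; apply: cdiff_div; first exact: sub_conj_neq0.
  exact: cdiffB (cdiff_id _) (cdiff_cst _ _).
exact: cdiffB (cdiff_id _) (cdiff_cst _ _).
Qed.

Lemma cdiff_blaschke s z : in_uhp s -> 0 <= Im z -> cdiff (blaschke s) z.
Proof.
move=> Hs z0; elim: s Hs => [|p s IH] Hs.
  by apply: cdiff_ext (cdiff_cst 1 z) => w; rewrite blaschke_nil.
have [p0 s0] := in_uhp_cons Hs.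
apply: cdiff_ext (cdiffM (cdiffX p.2 (cdiff_bfactor p0 z0)) (IH s0)) => w.
by rewrite blaschke_cons.
Qed.

End Blaschke.

(** * Densities and phases of finite Blaschke products *)

Section Density.
Context {R : realType}.
Implicit Types (a z w : R[i]) (s : seq (R[i] * nat)) (x t : R).

Definition density s x : R := \sum_(p <- s) p.2%:R * (Im p.1 / nc (x%:C - p.1) ^+ 2).

Lemma density_cons p s x :
  density (p :: s) x = p.2%:R * (Im p.1 / nc (x%:C - p.1) ^+ 2) + density s x.
Proof. by rewrite /density big_cons. Qed.

Lemma density_ge0 s x : in_uhp s -> 0 <= density s x.
Proof.
move=> Hs; rewrite /density big_seq sumr_ge0 // => p ps.
by rewrite mulr_ge0 // divr_ge0 ?sqr_ge0 // ltW // Hs.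
Qed.

(** The conjugate points move away from x as the point rises above x. *)
Lemma bmass_le_density s x y : in_uhp s -> 0 <= y ->
  bmass s (x +i* y) <= 4 * y * density s x.
Proof.
move=> Hs y0; rewrite /bmass /density mulr_sumr big_seq [leRHS]big_seq.
apply: ler_sum => p /Hs p0; rewrite [leRHS]mulrCA ler_wpM2l //.
have -> : bdefect p.1 (x +i* y) = 4 * y * (Im p.1 / nc (x +i* y - p.1^*) ^+ 2).
  by rewrite /bdefect /= !mulrA.
rewrite ler_wpM2l ?mulr_ge0 // ler_wpM2l ?(ltW p0) //.
have H : nc (x%:C - p.1) ^+ 2 <= nc (x +i* y - p.1^*) ^+ 2.
  rewrite !sqr_nc !ReImE /= lerD2l sub0r sqrrN opprK.
  by rewrite lerXn2r ?nnegrE ?addr_ge0 ?(ltW p0) // lerDr.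
rewrite lef_pV2 ?posrE //; first by rewrite exprn_gt0 // nc_sub_conj_gt0.
by rewrite exprn_gt0 // nc_gt0 subr_eq0; apply/eqP => /(congr1 (@Im R)) /=; lra.
Qed.

Definition cis t : R[i] := cexp (0 +i* t).

Lemma cisE t : cis t = cos t +i* sin t.
Proof. by rewrite /cis /cexp /= expR0 !mul1r. Qed.

Lemma cisD t u : cis (t + u) = cis t * cis u.
Proof. by rewrite /cis -cexpD; congr cexp; apply: complex_eqP; rewrite /= ?addr0. Qed.

Lemma nc_cis t : nc (cis t) = 1.
Proof. by rewrite /cis nc_cexp /= expR0. Qed.

Lemma cis0 : cis 0 = 1.
Proof. by rewrite cisE cos0 sin0. Qed.

Lemma cis_natM n t : cis (n%:R * t) = cis t ^+ n.
Proof.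
elim: n => [|n IH]; first by rewrite mul0r cis0 expr0.
by rewrite -natr1 mulrDl mul1r cisD IH exprSr.
Qed.

Lemma cis_lip t u : t <= u -> nc (cis u - cis t) <= 2 * (u - t).
Proof.
move=> tu; apply: le_trans (ler_nc_ReIm _) _; rewrite !cisE !ReImE /=.
have bd (f df : R -> R) : (forall x : R, is_derive x 1 f (df x)) ->
    (forall x, -1 <= df x <= 1) -> `|f u - f t| <= u - t.
  move=> fd Hd; rewrite ler_norml.
  have := mvt_le tu (fun x _ => fd x) (fun x _ => proj2 (andP (Hd x))).
  have := mvt_ge tu (fun x _ => fd x) (fun x _ => proj1 (andP (Hd x))).
  by rewrite mulN1r mul1r => -> ->.
have H1 : `|cos u - cos t| <= u - t.
  apply: (bd _ (fun x => - sin x)) => x.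
  by have := sin_le1 x; have := sin_geN1 x; lra.
have H2 : `|sin u - sin t| <= u - t.
  apply: (bd _ (fun x => cos x)) => x.
  by have := cos_le1 x; have := cos_geN1 x; lra.
lra.
Qed.

(** An argument of blaschke s x, up to a constant. *)
Definition bphase s x : R := \sum_(p <- s) p.2%:R * (2 * atan ((x - Re p.1) / Im p.1)).

Lemma bphase_cons p s x :
  bphase (p :: s) x = p.2%:R * (2 * atan ((x - Re p.1) / Im p.1)) + bphase s x.
Proof. by rewrite /bphase big_cons. Qed.

(** The argument of 1 + i v is atan v. *)
Lemma cis_2atan v : cis (2 * atan v) = (1 +i* v) / (1 -i* v).
Proof.
have v1 : 0 < 1 + v ^+ 2 by rewrite ltr_pwDl // sqr_ge0.
have cs : sin (atan v) = v * cos (atan v).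
  have := atanK v; rewrite /tan => H; rewrite -{2}H divfK // gt_eqF // cos_gt0_pihalf //.
  by rewrite atan_gtNpi2 atan_ltpi2.
have c2 : cos (atan v) ^+ 2 = (1 + v ^+ 2)^-1.
  by rewrite cos_atan exprVn sqr_sqrtr // ltW.
have nz : 1 -i* v != 0 by apply/eqP => -[/eqP]; rewrite oner_eq0.
apply: (mulIf nz); rewrite divfK //.
have -> : cis (2 * atan v) = cis (atan v) ^+ 2 by rewrite -cis_natM.
have -> : cis (atan v) = (cos (atan v))%:C * (1 +i* v).
  by rewrite cisE cs; apply: complex_eqP; rewrite ?ReM ?ImM /=; ring.
rewrite exprMn -rmorphXn c2 -mulrA.
have -> : (1 +i* v) ^+ 2 * (1 -i* v) = (1 + v ^+ 2)%:C * (1 +i* v).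
  by apply: complex_eqP; rewrite ?expr2 !ReImE /=; ring.
by rewrite mulrA -rmorphM mulVf ?gt_eqF // mul1r.
Qed.

Lemma bfactor_real a x : 0 < Im a ->
  bfactor a x%:C = - cis (2 * atan ((x - Re a) / Im a)).
Proof.
move=> a0; rewrite cis_2atan /bfactor; set v := (x - Re a) / Im a.
have vE : x - Re a = v * Im a by rewrite /v divfK // gt_eqF.
have -> : x%:C - a = - 'i * (Im a)%:C * (1 +i* v).
  by apply: complex_eqP; rewrite !ReImE /= ?vE; ring.
have -> : x%:C - conjc a = 'i * (Im a)%:C * (1 -i* v).
  by apply: complex_eqP; rewrite !ReImE /= ?vE; ring.
have n1 : 1 -i* v != 0 by apply/eqP => -[/eqP]; rewrite oner_eq0.
have n2 : (Im a)%:C != 0 by apply/eqP => -[/eqP]; rewrite gt_eqF.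
have n3 : 'i != 0 :> R[i] by apply/eqP => -[/eqP]; rewrite oner_eq0.
by field; rewrite n1 n2 n3.
Qed.

Lemma blaschke_phase s : in_uhp s -> exists2 u : R[i], nc u = 1 &
  forall x, blaschke s x%:C = u * cis (bphase s x).
Proof.
elim: s => [|p s IH] Hs.
  by exists 1; rewrite ?nc1 // => x; rewrite blaschke_nil /bphase big_nil cis0 mulr1.
have [p0 s0] := in_uhp_cons Hs; have [u u1 Hu] := IH s0.
exists ((-1) ^+ p.2 * u); first by rewrite ncM ncX ncN nc1 expr1n u1 mulr1.
move=> x; rewrite blaschke_cons bphase_cons bfactor_real // Hu cisD [cis (p.2%:R * _)]cis_natM.
by rewrite -[- cis _]mulN1r exprMn; ring.
Qed.

Lemma is_derive_bphase s x : in_uhp s -> is_derive x 1 (bphase s) (2 * density s x).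
Proof.
elim: s => [|p s IH] Hs.
  rewrite /density big_nil mulr0 (_ : bphase [::] = cst 0); first exact: is_derive_cst.
  by apply/funext => t; rewrite /bphase big_nil.
have [p0 s0] := in_uhp_cons Hs; have {}IH := IH s0.
have -> : bphase (p :: s) =
    (fun t => p.2%:R * (2 * atan ((t - Re p.1) / Im p.1))) + bphase s.
  by apply/funext => t; rewrite bphase_cons.
rewrite density_cons mulrDr; apply: is_deriveD.
apply: is_derive_eq; rewrite /GRing.scale /=.
rewrite sqr_nc !ReImE /= sub0r sqrrN.
move: (Re p.1) (Im p.1) (p.2%:R) p0 => r i n i0.
have h1 : 0 < i ^+ 2 + (x - r) ^+ 2 by rewrite ltr_pwDl ?sqr_ge0 ?exprn_gt0.
by field; rewrite (addrC (_ ^+ 2)) !gt_eqF.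
Qed.

End Density.

(** * The Blaschke product of a Hermite-Biehler function *)

Section UniqSums.
Context {R : realType} {T : choiceType}.

Lemma sum_uniq_split (X Z : seq T) (h : T -> R) : uniq X -> uniq Z ->
  {subset X <= Z} ->
  \sum_(i <- Z) h i = \sum_(i <- X) h i + \sum_(i <- Z | i \notin X) h i.
Proof.
move=> uX uZ XZ; rewrite (bigID (mem X)) /=; congr (_ + _).
rewrite -big_filter; apply: perm_big; apply: uniq_perm => //.
  exact: filter_uniq.
by move=> i; rewrite mem_filter; case: (boolP (i \in X)) => //= /XZ ->.
Qed.

Lemma ler_sum_uniq (X Z : seq T) (h : T -> R) : uniq X -> uniq Z ->
  {subset X <= Z} -> (forall i, i \in Z -> 0 <= h i) ->
  \sum_(i <- X) h i <= \sum_(i <- Z) h i.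
Proof.
move=> uX uZ XZ h0; rewrite (sum_uniq_split h uX uZ XZ) lerDl.
by rewrite big_seq_cond sumr_ge0 // => i /andP[/h0].
Qed.

End UniqSums.

(** An inner function given as a Blaschke product, without reference to an
enumeration of its zeros: s ranges over the finite sub-products. *)
Record blaschke_product {R : realType} (A : set (seq (R[i] * nat)))
    (Theta : R[i] -> R[i]) (F : R -> R) : Prop := {
  bp_uhp : forall s, A s -> in_uhp s;
  bp_density_le : forall s x, A s -> density s x <= F x;
  bp_density_ge : forall x e, 0 < e -> exists2 s, A s & F x - e <= density s x;
  bp_le : forall s z, A s -> 0 <= Im z -> nc (Theta z) <= nc (blaschke s z);
  bp_ge : forall z e, 0 < Im z -> 0 < e ->
    exists2 s, A s & nc (blaschke s z) <= nc (Theta z) + e;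
  bp_cdiff : forall z, 0 <= Im z -> cdiff Theta z;
  bp_real : forall x : R, nc (Theta x%:C) = 1
}.

Section HermiteBiehler.
Context {R : realType}.
Variables (E : R[i] -> R[i]) (phi : R -> R).
Hypothesis hE : hermite_biehler E.
Hypothesis hphi : phase_function E phi.
Hypothesis hsigma : phase_sigma E phi 0.
Implicit Types (l z w : R[i]) (X Y : seq R[i]).

Local Notation Theta := (fun z : R[i] => star E z / E z).
Local Notation F := (derive1 phi).

Lemma HB_cdiff z : cdiff E z.
Proof. by case: hE => H _ _; apply: cdiff_derivable. Qed.

Lemma HB_lt z : 0 < Im z -> nc (star E z) < nc (E z).
Proof. by case: hE => _ _ H /H; rewrite !norm_nc ltcR. Qed.

Lemma real_eq z : Im z = 0 -> z = (Re z)%:C.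
Proof. by case: z => a b /= ->. Qed.

Lemma HB_neq0 z : 0 <= Im z -> E z != 0.
Proof.
rewrite le_eqVlt => /orP[/eqP/esym/real_eq ->|/HB_lt]; first by case: hE.
by rewrite -nc_gt0; apply: le_lt_trans; exact: nc_ge0.
Qed.

Lemma zeros_lower l : zeros E l -> Im l < 0.
Proof. by rewrite /zeros /= => H; rewrite ltNge; apply/negP => /HB_neq0; rewrite H eqxx. Qed.

Lemma nc_Theta_le1 z : 0 <= Im z -> nc (Theta z) <= 1.
Proof.
move=> z0; have := HB_neq0 z0; rewrite -nc_gt0 => E0; rewrite ncM ncV ler_pdivrMr // mul1r.
move: z0; rewrite le_eqVlt => /orP[/eqP/esym/real_eq ->|/HB_lt/ltW //].
by rewrite /star nc_conj conjc_real.
Qed.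

Lemma nc_Theta_real (x : R) : nc (Theta x%:C) = 1.
Proof.
rewrite ncM ncV /star nc_conj conjc_real divff // nc_eq0.
by case: hE.
Qed.

(** If E had no order of vanishing at l, its multiplicity there would be 0, and
E itself would be the quotient; the factorization holds in any case. *)
Lemma factor1 l : exists2 g : R[i] -> R[i], forall z, cdiff g z &
  forall w, E w = (w - l) ^+ multiplicity E l * g w.
Proof.
rewrite /multiplicity; case: xgetP => [m _ [g [gE _ Hg]]|_].
  by exists g => // z; apply: cdiff_derivable; exact: gE.
by exists E => [z|w]; [exact: HB_cdiff|rewrite expr0 mul1r].
Qed.

Definition zpoly X w : R[i] := \prod_(l <- X) (w - l) ^+ multiplicity E l.

Lemma cdiff_zpoly X z : cdiff (zpoly X) z.
Proof.
apply: (@cdiff_prod _ _ _ (fun l w => (w - l) ^+ multiplicity E l)) => l.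
exact: cdiffX (cdiffB (cdiff_id _) (cdiff_cst _ _)).
Qed.

(** The quotients by X and by a further zero l are glued: away from l the former
is divided by a power of w - l, near l the latter by the zeros in X. *)
Lemma factor X : uniq X -> exists2 g : R[i] -> R[i], forall z, cdiff g z &
  forall w, E w = zpoly X w * g w.
Proof.
elim: X => [_|l X IH /= /andP[lX /IH[g gd Hg]]].
  by exists E => [z|w]; [exact: HB_cdiff|rewrite /zpoly big_nil mul1r].
have [g1 g1d Hg1] := factor1 l; set m := multiplicity E l in Hg1.
have Pl : zpoly X l != 0.
  rewrite /zpoly prodf_seq_neq0; apply/allP => k kX /=.
  rewrite expf_neq0 // subr_eq0; apply: contra lX; by move/eqP->.
have E12 w : w != l -> zpoly X w != 0 -> g w / (w - l) ^+ m = g1 w / zpoly X w.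
  move=> wl Pw; have wm : (w - l) ^+ m != 0 by rewrite expf_neq0 // subr_eq0.
  apply/eqP; rewrite eqr_div //; apply/eqP.
  by rewrite mulrC -Hg Hg1 mulrC.
exists (fun w => if w == l then g1 w / zpoly X w else g w / (w - l) ^+ m).
  move=> z; have [->|zl] := eqVneq z l.
    have /ccontP/(_ (nc (zpoly X l))) := cdiff_cont (cdiff_zpoly X l).
    rewrite nc_gt0 => /(_ Pl)[d d0 Hd].
    apply: (@cdiff_near _ (fun w => g1 w / zpoly X w) _ _ d) => //.
      move=> w /Hd wd; case: eqVneq => // wl; rewrite E12 //.
      apply: contraTN wd => /eqP ->; by rewrite sub0r ncN ltxx.
    exact: cdiff_div Pl (g1d l) (cdiff_zpoly X l).
  apply: (@cdiff_near _ (fun w => g w / (w - l) ^+ m) _ _ (nc (z - l))).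
  - by rewrite nc_gt0 subr_eq0.
  - move=> w; case: eqVneq => // ->; by rewrite nc_distC ltxx.
  - apply: cdiff_div (gd z) _; first by rewrite expf_neq0 // subr_eq0.
    exact: cdiffX (cdiffB (cdiff_id _) (cdiff_cst _ _)).
move=> w; rewrite /zpoly big_cons -/(zpoly X w) -/m; case: eqVneq => [->|wl].
  by rewrite mulrAC -mulrA divfK // Hg1.
have wm : (w - l) ^+ m != 0 by rewrite expf_neq0 // subr_eq0.
by rewrite Hg [RHS]mulrC mulrA divfK // mulrC.
Qed.

Definition zlist X : seq (R[i] * nat) := [seq (conjc l, multiplicity E l) | l <- X].

Definition zfamily : set (seq (R[i] * nat)) :=
  [set s | exists X, [/\ uniq X, forall l, l \in X -> zeros E l & s = zlist X]].

Lemma zlist_uhp X : (forall l, l \in X -> zeros E l) -> in_uhp (zlist X).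
Proof.
move=> HX p /mapP[l /HX /zeros_lower l0 ->] /=; by rewrite Im_conj oppr_gt0.
Qed.

Lemma star_zpoly X z : star (zpoly X) z = \prod_(p <- zlist X) (z - p.1) ^+ p.2.
Proof.
rewrite /star /zpoly rmorph_prod big_map /=; apply: eq_bigr => l _.
by rewrite rmorphXn rmorphB /= conjcK.
Qed.

Lemma blaschke_zlist X z : blaschke (zlist X) z = star (zpoly X) z / zpoly X z.
Proof.
rewrite star_zpoly /blaschke !big_map /= -prodf_div; apply: eq_bigr => l _ /=.
by rewrite /bfactor conjcK expr_div_n.
Qed.

(** Theta divided by a finite sub-product is bounded by 1: it is unimodular on
the real line, and at infinity the finite product tends to modulus 1. *)
Lemma quotient X : uniq X -> (forall l, l \in X -> zeros E l) ->
  exists f : R[i] -> R[i], [/\ forall z, 0 <= Im z -> cdiff f z,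
    forall z, 0 <= Im z -> Theta z = blaschke (zlist X) z * f z,
    forall z, 0 <= Im z -> nc (f z) <= 1 & forall x : R, nc (f x%:C) = 1].
Proof.
move=> uX HX; have [g gd Hg] := factor uX.
have g0 z : 0 <= Im z -> g z != 0.
  by move=> /HB_neq0; rewrite Hg mulf_eq0 negb_or => /andP[].
have P0 z : 0 <= Im z -> zpoly X z != 0.
  by move=> /HB_neq0; rewrite Hg mulf_eq0 negb_or => /andP[].
exists (fun z => star g z / g z).
have fd z : 0 <= Im z -> cdiff (fun z => star g z / g z) z.
  by move=> z0; apply: cdiff_div (gd z); [exact: g0|exact: cdiff_star].
have fE z : 0 <= Im z -> Theta z = blaschke (zlist X) z * (star g z / g z).
  move=> z0; rewrite blaschke_zlist {1}/star !Hg rmorphM /= -/(star (zpoly X) z) -/(star g z).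
  by field; rewrite g0 ?P0.
have fR (x : R) : nc (star g x%:C / g x%:C) = 1.
  by rewrite ncM ncV /star nc_conj conjc_real divff // nc_eq0 g0.
split=> //; apply: (@maximum_principle_infinity _ _ (fun z => Im z)) => //.
- exact: cont_Im.
- by move=> z /real_eq ->; rewrite fR.
move=> e e0; have [K HK] := blaschke_infinity (zlist_uhp HX) e0.
exists K => z z0 Kz; have := HK z z0 Kz; have := nc_Theta_le1 z0; rewrite fE // ncM.
move: (nc (blaschke _ _)) (nc_ge0 (blaschke (zlist X) z)) (nc (_ / _)) => b b0 f h1 h2.
have b1 : 0 < b by rewrite lt_neqAle b0 andbT; apply/eqP => b00; move: h2; rewrite -b00; lra.
by rewrite -(ler_pM2l b1); apply: le_trans h1 _; rewrite mulrC.
Qed.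

Lemma nc_real_conj (x : R) l : nc (x%:C - conjc l) = nc (x%:C - l).
Proof. by case: l => a b; rewrite /=; congr (Num.sqrt _); ring. Qed.

Lemma density_zlist X x :
  density (zlist X) x =
  \sum_(l <- X) (multiplicity E l)%:R * (- Im l / nc (x%:C - l) ^+ 2).
Proof.
rewrite /density big_map; apply: eq_bigr => l _ /=.
by rewrite Im_conj nc_real_conj.
Qed.

Lemma Im_inv z : Im (z^-1) = - Im z / nc z ^+ 2.
Proof. by rewrite sqr_nc; case: z => a b /=; rewrite mulNr. Qed.

Lemma phase_density (x : R) : (F x)%:E = \esum_(l in zeros E)
  ((multiplicity E l)%:R * (- Im l / nc (x%:C - l) ^+ 2))%:E.
Proof.
case: hsigma => _ ->; rewrite add0e; apply: eq_esum => l _.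
by rewrite Im_inv nc_real_conj ImB Im_conj /= sub0r opprK.
Qed.

Lemma density_le_phase X x : uniq X -> (forall l, l \in X -> zeros E l) ->
  density (zlist X) x <= F x.
Proof.
move=> uX HX; rewrite -lee_fin phase_density density_zlist; apply: esum_ge.
exists [set` X]; first by split; [exact: finite_seq|move=> l /HX].
by rewrite -fsbig_seq // sumEFin.
Qed.

Lemma phase_le_density x (e : R) : 0 < e ->
  exists X, [/\ uniq X, forall l, l \in X -> zeros E l &
    F x - e <= density (zlist X) x].
Proof.
move=> e0; apply: contrapT => H.
have : (F x <= F x - e); last by lra.
rewrite -lee_fin phase_density; apply: ge_ereal_sup => _ [A [/finite_fsetP[X ->] AZ] <-].
rewrite -fsbig_seq ?finmap.fset_uniq // sumEFin lee_fin -density_zlist leNgt.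
apply/negP => /ltW lt; apply: H; exists (finmap.enum_fset X); split=> //; first exact: finmap.fset_uniq.
Qed.

(** The distance to the set of zeros is continuous, and positive on the real line,
where E does not vanish. *)
Lemma zeros_away_from_segment (a b : R) : a <= b ->
  exists2 d, 0 < d & forall x l, a <= x <= b -> zeros E l -> d <= nc (x%:C - l).
Proof.
move=> ab; have [[l0 l0E]|noz] := pselect (exists l, zeros E l); last first.
  by exists 1 => // x l _ lE; case: noz; exists l.
pose S x := [set nc (x%:C - l) | l in zeros E].
have S0 x : S x !=set0 by exists (nc (x%:C - l0)); exists l0.
have lbS x : has_lbound (S x) by exists 0 => _ [l _ <-]; exact: nc_ge0.
pose r x := inf (S x).
have r_le x l : zeros E l -> r x <= nc (x%:C - l).
  by move=> lE; apply: ge_inf => //; exists l.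
have r_lip x y : r x <= r y + `|y - x|.
  rewrite -lerBlDr; apply: lb_le_inf => // _ [l lE <-].
  rewrite lerBlDr; apply: le_trans (r_le x l lE) _.
  apply: le_trans (ler_nc_dist y%:C _ _) _; rewrite addrC lerD2l -rmorphB nc_real.
  by rewrite distrC.
have r_gt0 x : 0 < r x.
  have Ex : E x%:C != 0 by case: hE.
  have /ccontP/(_ (nc (E x%:C))) := cdiff_cont (HB_cdiff x%:C).
  rewrite nc_gt0 => /(_ Ex)[d d0 Hd]; apply: lt_le_trans d0 _.
  apply: lb_le_inf => // _ [l lE <-]; rewrite leNgt nc_distC; apply/negP => /Hd.
  by rewrite (lE : E l = 0) sub0r ncN ltxx.
have r_cont : continuous r.
  move=> x B /nbhs_ballP[e /= e0 HB]; apply/nbhs_ballP; exists e => //= y.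
  rewrite -ball_normE /= => xy; apply: HB; rewrite -ball_normE /=.
  apply: le_lt_trans xy; rewrite ler_norml.
  have := r_lip x y; have := r_lip y x; rewrite distrC [`|y - x|]distrC; lra.
have [c cab Hc] := EVT_min ab (continuous_subspaceT r_cont).
exists (r c) => // x l xab lE; apply: le_trans (r_le x l lE); apply: Hc.
by rewrite in_itv.
Qed.

(** Harnack's inequality, term by term, makes the tails of the sum for the
phase derivative uniformly small on bounded intervals. *)
Lemma phase_density_uniform (a b e : R) : a <= b -> 0 < e ->
  exists X, [/\ uniq X, forall l, l \in X -> zeros E l &
    forall x, a <= x <= b -> F x - density (zlist X) x <= e].
Proof.
move=> ab e0; have [d d0 Hd] := zeros_away_from_segment ab.
pose C := (1 + (b - a) / d) ^+ 2.
have C1 : 1 <= 1 + (b - a) / d by rewrite lerDl divr_ge0 ?subr_ge0 // ltW.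
have C0 : 0 < C by rewrite exprn_gt0 //; lra.
have [X [uX HX HXe]] := phase_le_density a (divr_gt0 e0 C0).
exists X; split => // x xab; apply/ler_addgt0Pr => e' e'0.
have [Y [uY HY HYe]] := phase_le_density x e'0.
pose Z := undup (X ++ Y).
have HZ l : l \in Z -> zeros E l.
  by rewrite mem_undup mem_cat => /orP[/HX|/HY].
have uZ : uniq Z := undup_uniq _.
have XZ : {subset X <= Z} by move=> l lX; rewrite mem_undup mem_cat lX.
have YZ : {subset Y <= Z} by move=> l lX; rewrite mem_undup mem_cat lX orbT.
pose h x l := (multiplicity E l)%:R * (- Im l / nc (x%:C - l) ^+ 2) : R.
have h0 y l : l \in Z -> 0 <= h y l.
  move=> /HZ/zeros_lower l0; rewrite mulr_ge0 // divr_ge0 ?sqr_ge0 //; lra.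
have YZx : density (zlist Y) x <= density (zlist Z) x.
  by rewrite !density_zlist; apply: ler_sum_uniq => // l; exact: h0.
have Za := density_le_phase a uZ HZ.
have splitZ y : density (zlist Z) y = density (zlist X) y + \sum_(l <- Z | l \notin X) h y l.
  by rewrite !density_zlist (sum_uniq_split _ uX uZ XZ).
have tail : \sum_(l <- Z | l \notin X) h x l <= C * \sum_(l <- Z | l \notin X) h a l.
  rewrite mulr_sumr big_seq_cond [leRHS]big_seq_cond; apply: ler_sum => l /andP[lZ _].
  have lE := HZ l lZ; have l0 := zeros_lower lE.
  rewrite /h [leRHS]mulrCA ler_wpM2l // [leRHS]mulrCA ler_wpM2l //; first by lra.
  have dx := Hd x l xab lE; have da : d <= nc (a%:C - l) by apply: Hd => //; lra.
  rewrite ler_pdivlMr ?exprn_gt0 //; last by lra.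
  rewrite mulrC -ler_pdivlMr ?invr_gt0 ?exprn_gt0 //; last by lra.
  rewrite invrK -exprMn lerXn2r ?nnegrE ?mulr_ge0 ?nc_ge0 //; first lra.
  apply: le_trans (ler_nc_dist x%:C _ _) _; rewrite -rmorphB nc_real mulrDl mul1r addrC lerD2l.
  rewrite mulrAC ler_pdivlMr // ler_pM //; first by rewrite ltW.
  rewrite ler_norml; lra.
have : C * \sum_(l <- Z | l \notin X) h a l <= C * (e / C).
  rewrite ler_wpM2l ?(ltW C0) //; have := splitZ a; lra.
have -> : C * (e / C) = e by rewrite mulrC divfK // gt_eqF.
by have := splitZ x; lra.
Qed.

(** On a square standing on the real line the four rotations of f - c about the
centre of the square have a product that is small on the whole boundary,
because each boundary point is rotated to the base once. *)
Lemma square_trick (f : R[i] -> R[i]) (c : R[i]) (x y d : R) : 0 < y -> 0 <= d ->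
  (forall z, 0 <= Im z -> cdiff f z) ->
  (forall z, 0 <= Im z -> nc (f z - c) <= 2) ->
  (forall t : R, `|t - x| <= y -> nc (f t%:C - c) <= d) ->
  nc (f (x +i* y) - c) ^+ 4 <= 8 * d.
Proof.
move=> y0 d0 fd f2 fb; pose z := x +i* y.
pose r0 w : R[i] := w.
pose r1 w := z + 'i * (w - z).
pose r2 w := z + z - w.
pose r3 w := z - 'i * (w - z).
pose h w := (f (r0 w) - c) * (f (r1 w) - c) * (f (r2 w) - c) * (f (r3 w) - c).
pose g w := Num.min (y - `|Re w - x|) (y - `|Im w - y|).
have gP w : 0 <= g w -> (- y <= Re w - x <= y) /\ (- y <= Im w - y <= y).
  by rewrite /g le_min !subr_ge0 !ler_norml => /andP[].
have pos w : 0 <= g w -> [/\ 0 <= Im (r0 w), 0 <= Im (r1 w), 0 <= Im (r2 w) & 0 <= Im (r3 w)].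
  by move=> /gP[? ?]; rewrite /r0 /r1 /r2 /r3 !ReImE /=; split; lra.
have -> : nc (f (x +i* y) - c) ^+ 4 = nc (h z).
  have r1z : r1 z = z by rewrite /r1 subrr mulr0 addr0.
  have r2z : r2 z = z by rewrite /r2 addrK.
  have r3z : r3 z = z by rewrite /r3 subrr mulr0 subr0.
  by rewrite /h r1z r2z r3z !ncM; ring.
apply: (@maximum_principle _ h g (`|x| + 3 * y)).
- by rewrite mulr_ge0.
- have lip (k : R[i] -> R) (m : R) : (forall u v, `|k u - k v| <= nc (u - v)) ->
      forall u, {for u, continuous ((fun w => y - `|k w - m|) : R[i]^o -> R)}.
    move=> Hk u; apply: lip_rcont => v; apply: le_trans (Hk v u).
    have := ler_dist_dist (k v - m) (k u - m).
    have -> : k v - m - (k u - m) = k v - k u by ring.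
    by rewrite !ler_norml => /andP[? ?]; apply/andP; split; lra.
  apply: continuous_minr; apply: lip => u v.
    by rewrite -ReB ler_Re_nc.
  by rewrite -ImB ler_Im_nc.
- move=> w /gP[? ?]; apply: le_trans (ler_nc_ReIm _) _.
  have : `|Re w| <= `|x| + y.
    by rewrite -[Re w](subrK x) addrC; apply: le_trans (ler_normD _ _) _; rewrite lerD2l ler_norml.
  have : `|Im w| <= 2 * y by rewrite ler_norml; lra.
  lra.
- move=> w /pos[p0 p1 p2 p3].
  have rd (r : R[i] -> R[i]) : cdiff r w -> 0 <= Im (r w) -> cdiff (fun w => f (r w) - c) w.
    by move=> rw p; apply: cdiffB (cdiff_cst _ _); apply: cdiff_comp rw _; exact: fd.
  have lin : cdiff (fun w => 'i * (w - z)) w.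
    exact: cdiffM (cdiff_cst _ _) (cdiffB (cdiff_id _) (cdiff_cst _ _)).
  do 3?apply: cdiffM; apply: rd => //.
  + exact: cdiff_id.
  + exact: cdiffD (cdiff_cst _ _) lin.
  + exact: cdiffB (cdiff_cst _ _) (cdiff_id _).
  + exact: cdiffB (cdiff_cst _ _) lin.
- move=> w gw; have gw0 : 0 <= g w by rewrite gw.
  have [p0 p1 p2 p3] := pos w gw0; have [Rw Iw] := gP w gw0.
  have P0 := f2 _ p0; have P1 := f2 _ p1; have P2 := f2 _ p2; have P3 := f2 _ p3.
  have base (r : R[i]) : Im r = 0 -> `|Re r - x| <= y -> nc (f r - c) <= d.
    by move=> /real_eq ->; exact: fb.
  have prod4 (t1 t2 t3 t4 : R) : 0 <= t1 <= d -> 0 <= t2 <= 2 -> 0 <= t3 <= 2 ->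
      0 <= t4 <= 2 -> t1 * t2 * t3 * t4 <= 8 * d.
    move=> /andP[? ?] /andP[? ?] /andP[? ?] /andP[? ?].
    have -> : 8 * d = d * 2 * 2 * 2 by ring.
    by rewrite !ler_pM ?mulr_ge0.
  have bnd (u : R[i]) (m : R) : nc u <= m -> 0 <= nc u <= m by rewrite nc_ge0.
  move/bnd: P0 => P0; move/bnd: P1 => P1; move/bnd: P2 => P2; move/bnd: P3 => P3.
  have B r I0 R0 : 0 <= nc (f r - c) <= d := bnd _ _ (base r I0 R0).
  rewrite /h !ncM.
  have [N|N] : `|Im w - y| = y \/ `|Re w - x| = y.
  + move: gw; rewrite /g; case: leP => _ /eqP; rewrite subr_eq0 => /eqP; [right|left] => //.
  + have [I0|I0] : Im w = 0 \/ Im w = 2 * y.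
    * by move/eqP: N; rewrite eqr_norml => /andP[/orP[/eqP|/eqP] ? _]; [right|left]; lra.
    * by apply: prod4 => //; apply: B => //; rewrite ler_norml.
    * rewrite [X in X <= _](_ : _ = nc (f (r2 w) - c) * nc (f (r0 w) - c) *
        nc (f (r1 w) - c) * nc (f (r3 w) - c)); last by ring.
      apply: prod4 => //; apply: B; rewrite /r2 !ReImE /= ?I0; first by ring.
      rewrite ler_norml; lra.
  + have [I0|I0] : Re w - x = - y \/ Re w - x = y.
    * by move/eqP: N; rewrite eqr_norml => /andP[/orP[/eqP|/eqP] ? _]; [right|left]; lra.
    * rewrite [X in X <= _](_ : _ = nc (f (r1 w) - c) * nc (f (r0 w) - c) *
        nc (f (r2 w) - c) * nc (f (r3 w) - c)); last by ring.
      apply: prod4 => //; apply: B; rewrite /r1 !ReImE /=; first lra.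
      rewrite ler_norml; lra.
    * rewrite [X in X <= _](_ : _ = nc (f (r3 w) - c) * nc (f (r0 w) - c) *
        nc (f (r2 w) - c) * nc (f (r1 w) - c)); last by ring.
      apply: prod4 => //; apply: B; rewrite /r3 !ReImE /=; first lra.
      rewrite ler_norml; lra.
- by rewrite /g /= !subrr normr0 subr0 le_min !ltW.
Qed.

Lemma is_derive_phase (x : R) : is_derive x 1 phi (F x).
Proof.
by case: hphi => H _ _; apply: DeriveDef; [exact: (H 0%N)|rewrite derive1E].
Qed.

Lemma Theta_phase (x : R) : Theta x%:C = cis (2 * phi x).
Proof.
have E0 : (nc (E x%:C))%:C != 0.
  by apply/eqP => -[/eqP]; rewrite nc_eq0; apply/negP; case: hE.
case: hphi => _ _ /(_ x); rewrite norm_nc => Ex.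
have -> : star E x%:C = conjc (E x%:C) by rewrite /star conjc_real.
have EE : E x%:C = (nc (E x%:C))%:C * cis (- phi x).
  by rewrite {1}Ex cisE cosN sinN.
have cc : conjc (cis (- phi x)) = cis (phi x).
  by rewrite !cisE cosN sinN /= opprK.
have cM (a b : R[i]) : conjc (a * b) = conjc a * conjc b by exact: rmorphM.
rewrite EE cM cc; set r := nc _ in E0 *.
have -> : conjc r%:C = r%:C by exact: conjc_real.
have c0 : cis (- phi x) != 0 by rewrite -nc_gt0 nc_cis.
rewrite -mulf_div divff // mul1r; apply: (mulIf c0); rewrite divfK //.
by rewrite -cisD; congr cis; ring.
Qed.

(** Theta / B has argument 2 phi - bphase up to a constant, with a derivative
between 0 and 2 e1 on the base of the square centred at z. *)
Lemma blaschke_close z (e : R) : 0 < Im z -> 0 < e ->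
  exists X, [/\ uniq X, forall l, l \in X -> zeros E l &
    nc (blaschke (zlist X) z) <= nc (Theta z) + e].
Proof.
move=> y0 e0; pose x := Re z; pose y := Im z.
have zE : z = x +i* y by rewrite /x /y; case: (z).
(* chosen so that square_trick gives |f z - c|^4 <= e^4 *)
pose d := e ^+ 4 / 8; have d0 : 0 < d by rewrite divr_gt0 // exprn_gt0.
pose e1 := d / (8 * y).
have e1_gt0 : 0 < e1 by rewrite divr_gt0 // mulr_gt0.
have ab : x - y <= x + y by move: y0; rewrite -/y; lra.
have [X [uX HX HXe]] := phase_density_uniform ab e1_gt0.
exists X; split => //.
have [f [fd fE f1 fR]] := quotient uX HX.
have sX := zlist_uhp HX; have [u u1 Hu] := blaschke_phase sX.
pose psi t := 2 * phi t - bphase (zlist X) t.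
have u0 : u != 0 by rewrite -nc_gt0 u1.
have fpsi t : f t%:C = u^-1 * cis (psi t).
  have /= := fE t%:C (lexx _); rewrite Theta_phase Hu => H.
  apply: (mulfI u0); rewrite mulrA divff // mul1r.
  apply: (mulIf (_ : cis (bphase (zlist X) t) != 0)); first by rewrite -nc_gt0 nc_cis.
  by rewrite -cisD subrK H; ring.
have psid (t : R) : is_derive t 1 psi (2 * F t - 2 * density (zlist X) t).
  apply: is_deriveB (is_derive_bphase _ sX); exact: is_deriveZ (is_derive_phase t).
pose c := f (x - y)%:C.
have base (t : R) : `|t - x| <= y -> nc (f t%:C - c) <= d.
  rewrite ler_norml => /andP[tx1 tx2]; have at_ : x - y <= t by lra.
  have lo := mvt_ge at_ (fun v _ => psid v) (lo := 0).
  have hi := mvt_le at_ (fun v _ => psid v) (hi := 2 * e1).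
  rewrite /c !fpsi -mulrBr ncM ncV u1 invr1 mul1r.
  have l1 : psi (x - y) <= psi t.
    rewrite -subr_ge0; apply: le_trans (lo _); first by rewrite mul0r.
    by move=> v _; have := density_le_phase v uX HX; lra.
  apply: le_trans (cis_lip l1) _.
  have l2 : psi t - psi (x - y) <= 2 * e1 * (t - (x - y)).
    apply: hi => v vt; have : F v - density (zlist X) v <= e1 by apply: HXe; lra.
    lra.
  have l3 : 2 * e1 * (t - (x - y)) <= 2 * e1 * (2 * y).
    apply: ler_wpM2l; first by rewrite mulr_ge0 // ltW.
    by clear -tx2; lra.
  have : e1 * (8 * y) = d by rewrite /e1 divfK // gt_eqF // mulr_gt0.
  lra.
have f2 w : 0 <= Im w -> nc (f w - c) <= 2.
  move=> w0; apply: le_trans (ler_ncB _ _) _; rewrite /c fR; have := f1 w w0; lra.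
have := square_trick y0 (ltW d0) fd f2 base; rewrite -zE.
have -> : 8 * d = e ^+ 4 by rewrite /d mulrC divfK.
rewrite ler_pXn2r ?nnegrE ?nc_ge0 ?(ltW e0) // => fz.
have Bz := blaschke_le1 sX (ltW y0).
rewrite (fE z (ltW y0)) ncM.
have fz1 : 1 - e <= nc (f z).
  have : nc c <= nc (f z) + nc (f z - c).
    by rewrite -{1}(subKr (f z) c); exact: ler_ncB.
  by rewrite {1}/c fR; lra.
have : nc (blaschke (zlist X) z) * (1 - e) <= nc (blaschke (zlist X) z) * nc (f z).
  by rewrite ler_wpM2l ?nc_ge0.
have : nc (blaschke (zlist X) z) * e <= 1 * e by rewrite ler_wpM2r // ltW.
lra.
Qed.

Lemma HB_blaschke_product : blaschke_product zfamily Theta F.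
Proof.
split.
- by move=> _ [X [_ HX ->]]; exact: zlist_uhp.
- by move=> _ x [X [uX HX ->]]; exact: density_le_phase.
- move=> x e e0; have [X [uX HX H]] := phase_le_density x e0.
  by exists (zlist X) => //; exists X.
- move=> _ z [X [uX HX ->]] z0; have [f [_ fE f1 _]] := quotient uX HX.
  by rewrite fE // ncM ler_piMr ?nc_ge0 ?f1.
- move=> z e z0 e0; have [X [uX HX H]] := blaschke_close z0 e0.
  by exists (zlist X) => //; exists X.
- move=> z z0; apply: cdiff_div; [exact: HB_neq0|apply: cdiff_star|]; exact: HB_cdiff.
- exact: nc_Theta_real.
Qed.

End HermiteBiehler.

(** * Doubling and separation of the zeros *)

(** The zeros of positive multiplicity stay away from each real point x, in
units of the local scale 1 / F x. *)
Definition separated {R : realType} (A : set (seq (R[i] * nat))) (F : R -> R)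
    (c : R) : Prop :=
  forall s p x, A s -> p \in s -> (0 < p.2)%N -> c <= nc (x%:C - p.1) * F x.

Section PhaseDensity.
Context {R : realType}.
Variables (A : set (seq (R[i] * nat))) (Theta : R[i] -> R[i]) (F phi : R -> R).
Hypothesis hB : blaschke_product A Theta F.
Hypothesis phiD : forall x : R, is_derive x 1 phi (F x).
Hypothesis phi_incr : {homo phi : x y / x < y}.
Hypothesis FD : forall x : R, derivable F x 1.
Implicit Types (x t : R).

(** Harnack's inequality holds for each term of the sum. *)
Lemma density_harnack (s : seq (R[i] * nat)) x t (k : R) : in_uhp s -> 0 <= k ->
  (forall p, p \in s -> (0 < p.2)%N -> nc (t%:C - p.1) <= k * nc (x%:C - p.1)) ->
  density s x <= k ^+ 2 * density s t.
Proof.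
move=> Hs k0 Hk; rewrite /density mulr_sumr big_seq [leRHS]big_seq.
apply: ler_sum => p ps; rewrite [leRHS]mulrCA.
have [->|p2] := posnP p.2; first by rewrite !mul0r.
have p0 := Hs p ps; rewrite ler_wpM2l // [leRHS]mulrCA ler_wpM2l ?(ltW p0) //.
have pos u : 0 < nc (u%:C - p.1) ^+ 2.
  rewrite exprn_gt0 // nc_gt0 subr_eq0; apply/eqP => /(congr1 (@Im R)) /=; lra.
rewrite -[leLHS]mul1r ler_pdivrMr // mulrAC ler_pdivlMr // mul1r -exprMn.
by rewrite lerXn2r ?nnegrE ?mulr_ge0 ?nc_ge0 // Hk.
Qed.

Lemma harnack x t (k : R) : 0 <= k ->
  (forall s p, A s -> p \in s -> (0 < p.2)%N ->
     nc (t%:C - p.1) <= k * nc (x%:C - p.1)) ->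
  F x <= k ^+ 2 * F t.
Proof.
move=> k0 Hk; apply/ler_addgt0Pr => e e0.
have [s As Hs] := bp_density_ge hB x e0.
rewrite -lerBlDr; apply: le_trans Hs _.
apply: le_trans (density_harnack (bp_uhp hB As) k0 (fun p => Hk s p As)) _.
by rewrite ler_wpM2l ?sqr_ge0 // (bp_density_le hB).
Qed.

Lemma point_density s p x : A s -> p \in s -> (0 < p.2)%N ->
  Im p.1 / nc (x%:C - p.1) ^+ 2 <= F x.
Proof.
move=> As ps p2; apply: le_trans (bp_density_le hB x As).
have Hs := bp_uhp hB As; rewrite /density (big_rem p ps) /=.
have p0 : 0 <= Im p.1 / nc (x%:C - p.1) ^+ 2.
  by rewrite divr_ge0 ?sqr_ge0 // ltW // Hs.
apply: (@le_trans _ _ (p.2%:R * (Im p.1 / nc (x%:C - p.1) ^+ 2))).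
  by rewrite ler_peMl // ler1n.
rewrite lerDl big_seq sumr_ge0 // => q /mem_rem qs.
by rewrite mulr_ge0 // divr_ge0 ?sqr_ge0 // ltW // Hs.
Qed.

Lemma phase_ge0 x : 0 <= F x.
Proof.
apply/ler_addgt0Pr => e e0; have [s As _] := bp_density_ge hB x e0.
have := density_ge0 x (bp_uhp hB As); have := bp_density_le hB x As; lra.
Qed.

Lemma exists_zero : exists s p, [/\ A s, p \in s & (0 < p.2)%N].
Proof.
apply: contrapT => H.
have F0 x : F x = 0.
  apply/eqP; rewrite eq_le phase_ge0 andbT; apply/ler_addgt0Pr => e e0.
  have [s As] := bp_density_ge hB x e0; rewrite add0r.
  have -> : density s x = 0; last by lra.
  rewrite /density big_seq big1 // => p ps; have [->|p2] := posnP p.2.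
    by rewrite mul0r.
  by case: H; exists s, p.
have := phi_incr (ltr01 : 0 < 1 :> R).
have := @mvt_le _ phi F 0 1 0 ler01 (fun x _ => phiD x).
have F0' (x : R) : 0 <= x <= 1 -> F x <= 0 by rewrite F0.
by move=> /(_ F0'); lra.
Qed.

Lemma phase_gt0 x : 0 < F x.
Proof.
have [s [p [As ps p2]]] := exists_zero.
apply: lt_le_trans (point_density x As ps p2); have p0 := bp_uhp hB As ps.
rewrite divr_gt0 // exprn_gt0 // nc_gt0 subr_eq0.
by apply/eqP => /(congr1 (@Im R)) /=; lra.
Qed.

Lemma phase_continuous : continuous F.
Proof. by move=> x; apply: differentiable_continuous; apply/derivable1_diffP. Qed.

Lemma phi_continuous : continuous phi.
Proof.
move=> x; apply: differentiable_continuous; apply/derivable1_diffP.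
by have [] := phiD x.
Qed.

Lemma measure_itv (s t : bool) (a b : R) : a < b ->
  density_measure F (bounded_itv s t a b) = (phi b - phi a)%:E.
Proof.
move=> ab; rewrite /density_measure /bounded_itv.
have mF : measurable_fun (`]a, b[ : set (measurableTypeR R)) F.
  apply: measurable_funTS.
  by apply: continuous_measurable_fun; exact: phase_continuous.
have {}mF := proj2 (measurable_EFinP _ _) mF.
rewrite (integral_itv_bndoo _ _ mF) -(integral_itv_bndoo true false mF).
rewrite (@continuous_FTC2 _ F phi) //.
- exact/continuous_subspaceT/phase_continuous.
- split; first by move=> x _; have [] := phiD x.
    by apply: cvg_at_right_filter; exact: phi_continuous.
  by apply: cvg_at_left_filter; exact: phi_continuous.
- by move=> x _; rewrite derive1E; have [_] := phiD x.
Qed.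

Lemma phase_lt x t : x <= t -> phi x <= phi t.
Proof. by rewrite le_eqVlt => /orP[/eqP ->//|/phi_incr/ltW]. Qed.

(** A zero at distance d from x gives the interval of radius 2 d mass at least
1, so at the radius r of mass 1/2 all zeros are at distance at least r / 2 and
F is at most 4 F x on the radius r / 4, while two doublings carry the mass from
radius r to radius r / 4. *)
Lemma doubling_separated : locally_doubling (density_measure F) ->
  exists2 c, 0 < c & separated A F c.
Proof.
move=> [C C0 dbl].
pose G x r := phi (x + r) - phi (x - r).
have dblG x r : 0 < r -> G x (r + r) < 1 -> G x (r + r) <= C * G x r.
  move=> r0; have := dbl true true (x - r) (x + r).
  rewrite /double_itv (_ : (x + r - (x - r)) / 2 = r); last by field.
  rewrite (_ : x - r - r = x - (r + r)); last by ring.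
  rewrite (_ : x + r + r = x + (r + r)); last by ring.
  rewrite !measure_itv; [|lra|lra].
  by rewrite -EFinM lte_fin lee_fin; apply; lra.
(* F is at least 1 / (2 y) on the interval of centre Re p.1 and radius y = Im p.1,
   which lies within 2 d of x *)
have Gbig s p x : A s -> p \in s -> (0 < p.2)%N -> 1 <= G x (2 * nc (x%:C - p.1)).
  move=> As ps p2; have i0 := bp_uhp hB As ps.
  set d := nc _; have dx : `|x - Re p.1| <= d.
    by apply: le_trans (ler_Re_nc _); rewrite ReB.
  have di : Im p.1 <= d.
    apply: le_trans (ler_Im_nc _); rewrite ImB /= sub0r normrN; exact: ler_norm.
  move: dx; rewrite ler_norml => /andP[dx1 dx2].
  have lo : Re p.1 - Im p.1 <= Re p.1 + Im p.1 by lra.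
  have H1 : (2 * Im p.1)^-1 * (Re p.1 + Im p.1 - (Re p.1 - Im p.1)) <=
      phi (Re p.1 + Im p.1) - phi (Re p.1 - Im p.1).
    apply: mvt_ge lo (fun v _ => phiD v) _ => v vI.
    apply: le_trans (point_density v As ps p2).
    have H : nc (v%:C - p.1) ^+ 2 <= 2 * Im p.1 ^+ 2.
      rewrite sqr_nc ReB ImB /= sub0r sqrrN.
      have : (v - Re p.1) ^+ 2 <= Im p.1 ^+ 2.
        have : 0 <= (Im p.1 - (v - Re p.1)) * (Im p.1 + (v - Re p.1)).
          by rewrite mulr_ge0 //; lra.
        lra.
      lra.
    have n0 : 0 < nc (v%:C - p.1) ^+ 2.
      rewrite exprn_gt0 // nc_gt0 subr_eq0; apply/eqP => /(congr1 (@Im R)) /=; lra.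
    rewrite ler_pdivlMr // mulrC ler_pdivrMr ?mulr_gt0 //.
    by apply: le_trans H _; rewrite expr2; lra.
  have E1 : (2 * Im p.1)^-1 * (Re p.1 + Im p.1 - (Re p.1 - Im p.1)) = 1.
    by field; rewrite gt_eqF.
  have H2 : phi (Re p.1 + Im p.1) <= phi (x + 2 * d) by apply: phase_lt; lra.
  have H3 : phi (x - 2 * d) <= phi (Re p.1 - Im p.1) by apply: phase_lt; lra.
  rewrite /G; lra.
have Gmono x r1 r2 : r1 <= r2 -> G x r1 <= G x r2.
  move=> r12; have : phi (x + r1) <= phi (x + r2) by apply: phase_lt; lra.
  have : phi (x - r2) <= phi (x - r1) by apply: phase_lt; lra.
  rewrite /G; lra.
have Gc x : continuous (G x).
  move=> r; apply: (@cvgB _ R).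
    apply: (@continuous_comp _ _ _ (fun r => x + r) phi); last exact: phi_continuous.
    exact: (cvgD (@cvg_cst _ x _ _ _) cvg_id).
  apply: (@continuous_comp _ _ _ (fun r => x - r) phi); last exact: phi_continuous.
  exact: (cvgB (@cvg_cst _ x _ _ _) cvg_id).
exists (8 * C ^+ 2)^-1; first by rewrite invr_gt0 mulr_gt0 // exprn_gt0.
move=> s p x As ps p2; set d := nc _.
have d0 : 0 <= d := nc_ge0 _.
have Gd := Gbig s p x As ps p2; rewrite -/d in Gd.
have [|r r01 Gr] := @IVT _ (G x) 0 (2 * d) (1 / 2) (mulr_ge0 (ler0n _ 2) d0)
    (continuous_subspaceT (Gc x)).
  rewrite /G addr0 subr0 subrr; apply/andP; split.
    by rewrite ge_min divr_ge0.
  by rewrite le_max; apply/orP; right; move: Gd; rewrite /G; lra.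
move: r01; rewrite in_itv /= => /andP[r0 rd].
have r_gt0 : 0 < r.
  by rewrite lt_neqAle r0 andbT; apply/eqP => r00; move: Gr; rewrite /G -r00 addr0 subr0 subrr; lra.
have far s' p' : A s' -> p' \in s' -> (0 < p'.2)%N -> r / 2 <= nc (x%:C - p'.1).
  move=> As' ps' p2'; rewrite leNgt; apply/negP => lt.
  have := Gmono x (2 * nc (x%:C - p'.1)) r; have := Gbig s' p' x As' ps' p2'; lra.
have F4 t : `|t - x| <= r / 4 -> F t <= 2 ^+ 2 * F x.
  move=> tx; apply: harnack => // s' p' As' ps' p2'.
  have := far s' p' As' ps' p2'.
  have := ler_nc_dist t%:C x%:C p'.1; rewrite -rmorphB nc_real distrC; lra.
pose q := r / 4.
have q2 : r / 2 = q + q by rewrite /q; field.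
have q4 : r = r / 2 + r / 2 by field.
have q0 : 0 < q by rewrite divr_gt0.
have D1 : G x r <= C * G x (r / 2).
  by rewrite {1}q4; apply: dblG; [rewrite divr_gt0|rewrite -q4 Gr; lra].
have D2 : G x (r / 2) <= C * G x q.
  rewrite q2; apply: dblG => //; rewrite -q2.
  have := Gmono x (r / 2) r; lra.
have D3 : G x q <= 4 * F x * (x + q - (x - q)).
  apply: mvt_le (fun v _ => phiD v) _; first lra.
  move=> v vI; have := F4 v; rewrite (_ : 2 ^+ 2 = 4 :> R); last by ring.
  by apply; rewrite -/q ler_norml; lra.
have D4 : C * G x q <= C * (2 * r * F x).
  rewrite ler_wpM2l ?(ltW C0) //; apply: le_trans D3 _; rewrite /q; lra.
have D5 : C * G x (r / 2) <= C * (C * (2 * r * F x)).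
  by rewrite ler_wpM2l ?(ltW C0) //; exact: le_trans D2 D4.
have D6 : C * (C * (2 * r * F x)) <= C * (C * (2 * (2 * d) * F x)).
  by rewrite !ler_wpM2l ?(ltW C0) // ler_wpM2r ?phase_ge0 // ler_wpM2l.
rewrite -[leLHS]mul1r ler_pdivrMr ?mulr_gt0 ?exprn_gt0 // expr2; lra.
Qed.

(** Moving from x to t changes the distance to a zero by at most the factor
1 + |t - x| / |x - a|. *)
Lemma separated_harnack c x t : 0 < c -> separated A F c ->
  F x <= (1 + `|t - x| * F x / c) ^+ 2 * F t.
Proof.
move=> c0 sep; apply: harnack.
  by rewrite addr_ge0 // divr_ge0 ?(ltW c0) // mulr_ge0 // phase_ge0.
move=> s p As ps p2; apply: le_trans (ler_nc_dist x%:C _ _) _.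
rewrite -rmorphB nc_real addrC mulrDl mul1r lerD2l; set n := nc _.
have -> : `|t - x| * F x / c * n = `|t - x| * (n * F x / c) by ring.
by rewrite ler_peMr // ler_pdivlMr // mul1r; exact: (sep s).
Qed.

(** To first order, separated_harnack bounds F t below by F x minus
(2 / c) (F x)^2 |t - x|, on both sides of x. *)
Lemma derive_phase_le c x (l : R) : 0 < c -> separated A F c ->
  is_derive x 1 F l -> `|l| <= 2 / c * F x ^+ 2.
Proof.
move=> c0 sep lD; apply/ler_addgt0Pr => e e0.
have low t : F x - 2 / c * F x ^+ 2 * `|t - x| <= F t.
  have := separated_harnack x t c0 sep; set ta := `|t - x| * F x / c => H.
  have ta0 : 0 <= ta by rewrite divr_ge0 ?(ltW c0) // mulr_ge0 ?phase_ge0.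
  have -> : F x - 2 / c * F x ^+ 2 * `|t - x| = F x * (1 - 2 * ta).
    by rewrite /ta; field; rewrite gt_eqF.
  have [neg|pos] := leP (1 - 2 * ta) 0.
    by apply: le_trans (phase_ge0 t); rewrite mulr_ge0_le0 // phase_ge0.
  apply: le_trans (_ : (1 + ta) ^+ 2 * F t * (1 - 2 * ta) <= _).
    by rewrite ler_wpM2r // ltW.
  have : 0 <= F t * (3 * ta ^+ 2 + 2 * ta ^+ 3).
    by rewrite mulr_ge0 ?phase_ge0 // addr_ge0 // mulr_ge0 ?exprn_ge0.
  have -> : (1 + ta) ^+ 2 * F t * (1 - 2 * ta) = F t - F t * (3 * ta ^+ 2 + 2 * ta ^+ 3).
    by ring.
  lra.
have [d d0 Hd] := is_derive_expand lD e0.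
pose h := d / 2; have h0 : 0 < h by rewrite divr_gt0.
have hd : h < d by rewrite /h; lra.
have Hp := Hd h; have Hm := Hd (- h).
have Lp := low (x + h); have Lm := low (x - h).
move: Hp Hm Lp Lm; rewrite normrN (gtr0_norm h0) => /(_ hd) Hp /(_ hd) Hm.
rewrite (_ : x + h - x = h); last by ring.
rewrite (_ : x - h - x = - h); last by ring.
rewrite normrN (gtr0_norm h0) => Lp Lm.
move: Hp Hm; rewrite !ler_norml => /andP[Hp1 Hp2] /andP[Hm1 Hm2].
set L := 2 / c * F x ^+ 2 in Lp Lm *.
have P1 : - (L + e) * h <= l * h by lra.
have P2 : l * h <= (L + e) * h by lra.
by move: P1 P2; rewrite !ler_pM2r // => -> ->.
Qed.

(** By the bound on F' the functions ln F + L phi and ln F - L phi are monotone,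
so that F varies by a bounded factor on intervals of mass at most 1. *)
Lemma separated_doubling c : 0 < c -> separated A F c ->
  locally_doubling (density_measure F).
Proof.
move=> c0 sep; pose L := 2 / c; have L0 : 0 < L by rewrite divr_gt0.
have lnD x : is_derive x 1 (fun t => ln (F t)) ('D_1 F x / F x).
  have F1 : is_derive x 1 F ('D_1 F x) by apply: DeriveDef.
  have := is_derive1_comp (is_derive1_ln (phase_gt0 x)) F1.
  by rewrite mulrC.
have bound x : `|'D_1 F x / F x| <= L * F x.
  rewrite normrM normfV (gtr0_norm (phase_gt0 x)) ler_pdivrMr ?phase_gt0 //.
  by rewrite -mulrA -expr2; apply: derive_phase_le; last by apply: DeriveDef.
have comp u v : u <= v -> phi v - phi u <= 1 ->
    F u <= expR L * F v /\ F v <= expR L * F u.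
  move=> uv m1.
  have Lm : L * (phi v - phi u) <= L by rewrite -[leRHS]mulr1 ler_wpM2l // ltW.
  have H1 : ln (F v) - L * phi v - (ln (F u) - L * phi u) <= 0 * (v - u).
    apply: (mvt_le uv (fun t _ => is_deriveB (lnD t) (is_deriveZ L (phiD t)))) => t _.
    by have := bound t; rewrite /GRing.scale /= ler_norml; lra.
  have H2 : 0 * (v - u) <= ln (F v) + L * phi v - (ln (F u) + L * phi u).
    apply: (mvt_ge uv (fun t _ => is_deriveD (lnD t) (is_deriveZ L (phiD t)))) => t _.
    by have := bound t; rewrite /GRing.scale /= ler_norml; lra.
  rewrite -[F u]lnK ?posrE ?phase_gt0 // -[F v]lnK ?posrE ?phase_gt0 // -!expRD !ler_expR.
  split; lra.
exists (2 * expR L ^+ 2); first by rewrite mulr_gt0 // exprn_gt0 // expR_gt0.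
move=> s t a b ab; rewrite /double_itv !measure_itv //; last by lra.
set h := (b - a) / 2; rewrite -EFinM lte_fin lee_fin => m1.
have hE : b - a = 2 * h by rewrite /h; field.
have h0 : 0 < h by rewrite divr_gt0 // subr_gt0.
have e0 := expR_gt0 L.
have mono u v : u <= v -> phi u <= phi v := @phase_lt u v.
have cl u : a - h <= u <= b + h -> F u <= expR L * F a /\ F a <= expR L * F u.
  move=> /andP[u1 u2]; have M1 := mono _ _ u1; have M2 := mono _ _ u2.
  have ah : a - h <= a by lra.
  have M3 := mono _ _ ah; have bh : a <= b + h by lra.
  have M4 := mono _ _ bh; have [ua|au] := leP u a.
    by apply: comp => //; lra.
  by have [|H1 H2] := comp a u (ltW au); first by lra.
have H1 : phi (b + h) - phi (a - h) <= expR L * F a * (b + h - (a - h)).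
  apply: mvt_le (fun v _ => phiD v) _; first lra.
  by move=> v vI; have [] := cl v vI.
have H2 : F a / expR L * (b - a) <= phi b - phi a.
  apply: mvt_ge (fun v _ => phiD v) _; first exact: ltW.
  move=> v vI; rewrite ler_pdivrMr // mulrC; have [] := cl v _ => //; lra.
have H3 : 2 * expR L ^+ 2 * (F a / expR L * (b - a)) <= 2 * expR L ^+ 2 * (phi b - phi a).
  by rewrite ler_wpM2l // mulr_ge0 // sqr_ge0.
apply: le_trans H1 (le_trans _ H3).
rewrite (_ : 2 * expR L ^+ 2 * (F a / expR L * (b - a)) = 2 * expR L * F a * (b - a)).
  by rewrite le_eqVlt; apply/orP; left; apply/eqP; rewrite /h; field.
by field; rewrite gt_eqF.
Qed.

End PhaseDensity.

(** * Separation implies the one component condition *)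

Section SeparatedOneComponent.
Context {R : realType}.
Variables (A : set (seq (R[i] * nat))) (Theta : R[i] -> R[i]) (F phi : R -> R).
Hypothesis hB : blaschke_product A Theta F.
Hypothesis phiD : forall x : R, is_derive x 1 phi (F x).
Hypothesis phi_incr : {homo phi : x y / x < y}.
Hypothesis FD : forall x : R, derivable F x 1.
Implicit Types (x y t : R) (z w : R[i]).
Variable c : R.
Hypothesis c0 : 0 < c.
Hypothesis sep : separated A F c.

Let F_gt0 x : 0 < F x := phase_gt0 hB phiD phi_incr x.

Lemma blaschke_mono (s : seq (R[i] * nat)) z w : in_uhp s -> 0 <= Im z -> 0 <= Im w ->
  (forall p, p \in s -> (0 < p.2)%N -> bdefect p.1 z <= bdefect p.1 w) ->
  nc (blaschke s w) <= nc (blaschke s z).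
Proof.
move=> Hs z0 w0; elim: s Hs => [|p s IH] Hs Hd; first by rewrite !blaschke_nil.
have [p0 s0] := in_uhp_cons Hs.
rewrite !blaschke_cons !ncM !ncX ler_pM ?exprn_ge0 ?nc_ge0 //; last first.
  by apply: IH => // q qs; apply: Hd; rewrite inE qs orbT.
have [->|p2] := posnP p.2; first by rewrite !expr0.
rewrite lerXn2r ?nnegrE ?nc_ge0 // -(@ler_pXn2r _ 2) ?nnegrE ?nc_ge0 //.
by rewrite !sqr_nc_bfactor // lerD2l lerN2 Hd // inE eqxx.
Qed.

(** The defect of one factor at height y is a multiple of
y / (|x - a|^2 + 2 y Im a + y^2), which increases as long as y <= |x - a|. *)
Lemma vertical_mono x y y' : 0 < y -> y <= y' -> y' <= c / F x ->
  nc (Theta (x +i* y')) <= nc (Theta (x +i* y)).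
Proof.
move=> y0 yy' y'c; apply/ler_addgt0Pr => e e0.
have y'0 : 0 < y' by lra.
have [//|s As Hs] := bp_ge hB (_ : 0 < Im (x +i* y)) e0.
apply: le_trans (bp_le hB As (_ : 0 <= Im (x +i* y'))) _; first exact: ltW.
apply: le_trans Hs; apply: blaschke_mono (bp_uhp hB As) _ _ _; rewrite /= ?ltW //.
move=> p ps p2; have p0 := bp_uhp hB As ps.
have yd : y' <= nc (x%:C - p.1).
  apply: le_trans y'c _; rewrite ler_pdivrMr ?F_gt0 //; exact: (sep x As ps p2).
have yd2 : y * y' <= nc (x%:C - p.1) ^+ 2.
  by rewrite expr2 ler_pM //; lra.
rewrite /bdefect /= ler_pdivrMr ?exprn_gt0 ?nc_sub_conj_gt0 //=; last exact: ltW.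
rewrite [leRHS]mulrAC ler_pdivlMr ?exprn_gt0 ?nc_sub_conj_gt0 //=; last exact: ltW.
move: yd2; rewrite !sqr_nc !ReImE /= sub0r sqrrN opprK.
set d := (x - Re p.1) ^+ 2; set i := Im p.1 => H.
have P : 0 <= i * ((y' - y) * (d + i ^+ 2 - y * y')).
  by rewrite !mulr_ge0 ?(ltW p0) ?subr_ge0.
have -> : 4 * y' * i * (d + (y + i) ^+ 2) =
  4 * y * i * (d + (y' + i) ^+ 2) + 4 * (i * ((y' - y) * (d + i ^+ 2 - y * y'))) by ring.
lra.
Qed.

(** At height y <= |x - a| one has |x + i y - conj a| <= 2 |x - a|, so bmass is at
least y times the density of s, and s may carry half of F x. *)
Lemma graph_bound x : nc (Theta (x +i* (c / F x))) ^+ 2 <= expR (- (c / 2)).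
Proof.
set y := c / F x; have y0 : 0 < y by rewrite divr_gt0.
have Fh : 0 < F x / 2 by rewrite divr_gt0.
have [s As Hs] := bp_density_ge hB x Fh.
have z0 : 0 <= Im (x +i* y) by rewrite ltW.
apply: (@le_trans _ _ (nc (blaschke s (x +i* y)) ^+ 2)).
  by rewrite lerXn2r ?nnegrE ?nc_ge0 // (bp_le hB As).
apply: le_trans (blaschke_le_exp (bp_uhp hB As) z0) _; rewrite ler_expR lerN2.
apply: (@le_trans _ _ (y * density s x)).
  have -> : c / 2 = y * (F x / 2) by rewrite /y; field; rewrite gt_eqF.
  by rewrite ler_wpM2l ?(ltW y0) //; lra.
rewrite /density /bmass mulr_sumr big_seq [leRHS]big_seq; apply: ler_sum => p ps.
have [->|p2] := posnP p.2; first by rewrite !mul0r mulr0.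
have p0 := bp_uhp hB As ps; rewrite mulrCA ler_wpM2l // /bdefect /=.
have yd : y <= nc (x%:C - p.1).
  by rewrite ler_pdivrMr ?F_gt0 //; exact: (sep x As ps p2).
have n1 : 0 < nc (x%:C - p.1) := lt_le_trans y0 yd.
have n2 : 0 < nc (x +i* y - conjc p.1) by apply: nc_sub_conj_gt0.
have le2 : nc (x +i* y - conjc p.1) <= 2 * nc (x%:C - p.1).
  apply: le_trans (ler_nc_dist x%:C _ _) _.
  have -> : nc (x +i* y - x%:C) = y.
    have -> : x +i* y - x%:C = 'i * y%:C by apply: complex_eqP; rewrite !ReImE /=; ring.
    by rewrite ncM nc_real (gtr0_norm y0) /= expr0n expr1n add0r sqrtr1 mul1r.
  by rewrite nc_real_conj; lra.
have le4 : nc (x +i* y - conjc p.1) ^+ 2 <= 4 * nc (x%:C - p.1) ^+ 2.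
  have -> : 4 * nc (x%:C - p.1) ^+ 2 = (2 * nc (x%:C - p.1)) ^+ 2 by ring.
  by rewrite lerXn2r ?nnegrE ?mulr_ge0 ?nc_ge0.
rewrite mulrA ler_pdivrMr ?exprn_gt0 // [leRHS]mulrAC ler_pdivlMr ?exprn_gt0 //.
have -> : 4 * y * Im p.1 * nc (x%:C - p.1) ^+ 2 = y * Im p.1 * (4 * nc (x%:C - p.1) ^+ 2) by ring.
by rewrite ler_wpM2l // mulr_ge0 // ltW.
Qed.

Lemma le_of_pow (a b N : R) : 0 <= a -> 0 < b ->
  (forall k : nat, a ^+ k <= b ^+ k * N) -> a <= b.
Proof.
move=> a0 b0 H; rewrite leNgt; apply/negP => ba.
pose r := a / b - 1; have r0 : 0 < r by rewrite subr_gt0 ltr_pdivlMr // mul1r.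
have bern k : 1 + k%:R * r <= (1 + r) ^+ k.
  elim: k => [|k IH]; first by rewrite mul0r addr0 expr0.
  rewrite exprS -natr1; have : 0 <= k%:R * r * r by rewrite !mulr_ge0 // ltW.
  have : (1 + r) * (1 + k%:R * r) <= (1 + r) * (1 + r) ^+ k.
    by rewrite ler_wpM2l //; lra.
  lra.
have N0 : 0 <= N by have := H 0%N; rewrite !expr0; lra.
have Nr : 0 <= N / r by rewrite divr_ge0 // ltW.
have := archi_boundP Nr; set k := Num.bound _; rewrite ltr_pdivrMr // => Nk.
have rE : 1 + r = a / b by rewrite /r addrC subrK.
have := bern k; rewrite rE expr_div_n.
have : a ^+ k / b ^+ k <= N by rewrite ler_pdivrMr ?exprn_gt0 // mulrC.
lra.
Qed.

(** The bound of graph_bound, without the square. *)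
Definition level : R := expR (- (c / 4)).

Lemma level_sqr : level ^+ 2 = expR (- (c / 2)).
Proof. by rewrite /level -expRM_natl; congr expR; field. Qed.

Lemma level_lt1 : level < 1.
Proof. by rewrite /level expR_lt1; have := c0; lra. Qed.

Lemma level_gt0 : 0 < level.
Proof. exact: expR_gt0. Qed.

Lemma height_continuous : continuous (fun x => c / F x).
Proof.
move=> x; apply: cvgM; first exact: cvg_cst.
apply: cvgV; [by rewrite gt_eqF|exact: (phase_continuous FD)].
Qed.

Lemma nc_shift_i z : 0 <= Im z -> 1 <= nc (z + 'i).
Proof.
by move=> z0; apply: le_trans (ler_Im_nc _); rewrite ImD /= ger0_norm; lra.
Qed.

(** The maximum principle in the region above the graph; the factor 1 / (z + i)
makes a power of Theta small at infinity, and its effect disappears after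
extracting roots. *)
Lemma above_graph z : c / F (Re z) <= Im z -> nc (Theta z) <= level.
Proof.
move=> zab; have Imz w : 0 <= Im w - c / F (Re w) -> 0 <= Im w.
  by have H : 0 < c / F (Re w) by [rewrite divr_gt0]; move=> ?; lra.
apply: (@le_of_pow _ _ (nc (z + 'i))); rewrite ?nc_ge0 ?level_gt0 // => k.
have z0 : 0 <= Im z by apply: Imz; lra.
have shift w : 0 <= Im w -> w + 'i != 0.
  by move=> w0; rewrite -nc_gt0; apply: lt_le_trans (nc_shift_i w0).
have H := @maximum_principle_infinity _ (fun w => Theta w ^+ k / (w + 'i))
  (fun w => Im w - c / F (Re w)) (level ^+ k).
rewrite mulrC -ler_pdivrMl; last by rewrite nc_gt0 shift.
rewrite mulrC -ncX -ncV -ncM; apply: H.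
- by rewrite exprn_ge0 // ltW ?level_gt0.
- move=> w; have h := continuous_comp (@cont_Re R w) (@height_continuous (Re w)).
  exact: (cvgB (@cont_Im R w) h).
- move=> w /Imz w0; apply: cdiff_div; first exact: shift.
    exact/cdiffX/(bp_cdiff hB).
  exact: cdiffD (cdiff_id _) (cdiff_cst _ _).
- move=> w wg; have w0 : 0 <= Im w by apply: Imz; rewrite wg.
  have wE : w = Re w +i* (c / F (Re w)).
    by apply: complex_eqP => //=; lra.
  rewrite ncM ncV ncX ler_pdivrMr; last by rewrite nc_gt0 shift.
  apply: (@le_trans _ _ (level ^+ k)).
    rewrite lerXn2r ?nnegrE ?nc_ge0 ?(ltW level_gt0) //.
    rewrite -(@ler_pXn2r _ 2) ?nnegrE ?nc_ge0 ?(ltW level_gt0) // level_sqr wE.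
    exact: graph_bound.
  by rewrite ler_peMr ?nc_shift_i // exprn_ge0 // ltW ?level_gt0.
- move=> e e0; exists (1 + e^-1) => w /Imz w0 wK.
  have n1 : e^-1 <= nc (w + 'i).
    have := ler_dist_nc w (- 'i); rewrite opprK ncN.
    have -> : nc ('i : R[i]) = 1 by rewrite /= expr0n expr1n add0r sqrtr1.
    rewrite ler_norml; lra.
  have ei : 0 < e^-1 by rewrite invr_gt0.
  have T1 : nc (Theta w) <= 1.
    have [s As _] := bp_density_ge hB 0 ltr01.
    exact: le_trans (bp_le hB As w0) (blaschke_le1 (bp_uhp hB As) w0).
  apply: (@le_trans _ _ e); last by rewrite lerDr exprn_ge0 // ltW ?level_gt0.
  rewrite ncM ncV ncX ler_pdivrMr ?nc_gt0 ?shift //.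
  apply: (@le_trans _ _ 1); first by rewrite exprn_ile1 ?nc_ge0.
  by rewrite -[X in X <= _](@mulfV _ e) ?gt_eqF // ler_wpM2l // ltW.
- by lra.
Qed.

Lemma continuous_complex (u v : R -> R) : continuous u -> continuous v ->
  continuous ((fun t => u t +i* v t) : R -> R[i]^o).
Proof.
move=> uc vc t; have p : (fun t => (u t, v t)) @ t --> (u t, v t) by exact: cvg_pair (uc t) (vc t).
exact: (continuous_comp p (@continuous_pair_complex R _)).
Qed.

(** Every point of the level set is joined to the graph by a vertical segment
inside the level set. *)
Lemma separated_one_component : one_component Theta.
Proof.
have l0 := level_gt0; have l1 := level_lt1.
exists ((1 + level) / 2); split; [lra|lra|].
set eps := (1 + level) / 2.
pose L := [set z : R[i] | 0 < Im z /\ nc (Theta z) < eps].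
have -> : [set z | upper_half_plane z /\ `|Theta z| < eps%:C] = L.
  by apply/seteqP; split => z; rewrite /L /upper_half_plane /= norm_nc ltcR.
pose gr x : R[i]^o := x +i* (c / F x).
have h0 x : 0 < c / F x by rewrite divr_gt0.
pose lo z := Num.min (Im z) (c / F (Re z)).
pose hi z := Num.max (Im z) (c / F (Re z)).
pose V z : set R[i]^o := [set (Re z +i* t : R[i]^o) | t in `[lo z, hi z]].
pose G : set R[i]^o := [set gr x | x in [set: R]].
have GL : G `<=` L.
  move=> _ [x _ <-]; split => //=; apply: le_lt_trans (above_graph _) _ => //=.
  by rewrite /eps; lra.
have VL z : L z -> V z `<=` L.
  move=> [z0 zl] w [t /=]; rewrite in_itv /= => /andP[t1 t2] <-; split => /=.
    by apply: lt_le_trans t1; rewrite lt_min z0 h0.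
  have [zt|tz] := leP (c / F (Re z)) t.
    by apply: le_lt_trans (above_graph _) _ => //=; rewrite /eps; lra.
  have zt : Im z <= t.
    by move: t1; rewrite /lo ge_min => /orP[//|H]; lra.
  apply: le_lt_trans zl; have -> : z = Re z +i* Im z by case: (z).
  by apply: vertical_mono => //; exact: ltW.
have Gc : connected G.
  apply: connected_continuous_connected.
    by apply/connected_intervalP => x y _ _ t _.
  apply: continuous_subspaceT; apply: (@continuous_complex id (fun x => c / F x)).
    by move=> x; exact: cvg_id.
  exact: height_continuous.
have Vc z : connected (V z).
  apply: connected_continuous_connected.
    exact/connected_intervalP/interval_is_interval.
  apply: continuous_subspaceT; apply: (@continuous_complex (fun=> Re z) id) => t.
    exact: cvg_cst.
  exact: cvg_id.
have zV z : V z z.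
  exists (Im z); last by case: (z).
  by rewrite /= in_itv /= /lo /hi ge_min le_max !lexx.
have VG z : (V z `&` G) (gr (Re z)).
  split; last by exists (Re z).
  by exists (c / F (Re z)); rewrite //= in_itv /= /lo /hi ge_min le_max !lexx !orbT.
have -> : L = \bigcup_(z in L) (V z `|` G).
  apply/seteqP; split => [z Lz|z [w Lw [/VL|/GL]]]; [|exact|by []].
  by exists z => //; left.
apply: bigcup_connected.
  by exists (gr 0) => z _; right; exists 0.
move=> z _; apply: connectedU => //; by exists (gr (Re z)).
Qed.

End SeparatedOneComponent.

(** * The one component condition implies separation *)

Section Balls.
Context {R : realType}.
Implicit Types (s : seq (R[i] * nat)) (z w : R[i]).

(** An upper bound for - 2 ln |blaschke s z|; the distance to the zeros replaces the
distance to their conjugates in bmass. *)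
Definition btail s z : R :=
  \sum_(p <- s) p.2%:R * (4 * Im z * Im p.1 / nc (z - p.1) ^+ 2).

Lemma btail_cons p s z : btail (p :: s) z =
  p.2%:R * (4 * Im z * Im p.1 / nc (z - p.1) ^+ 2) + btail s z.
Proof. by rewrite /btail big_cons. Qed.

Lemma blaschke_ge_exp s z : in_uhp s -> 0 <= Im z ->
  (forall p, p \in s -> z != p.1) ->
  expR (- btail s z) <= nc (blaschke s z) ^+ 2.
Proof.
move=> Hs z0; elim: s Hs => [|p s IH] Hs zp.
  by rewrite blaschke_nil nc1 expr1n /btail big_nil oppr0 expR0.
have [p0 s0] := in_uhp_cons Hs.
rewrite btail_cons opprD expRD blaschke_cons ncM ncX exprMn exprAC.
apply: ler_pM; rewrite ?expR_ge0 //; last first.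
  by apply: IH => // q qs; apply: zp; rewrite inE qs orbT.
rewrite -mulrN expRM_natl lerXn2r ?nnegrE ?expR_ge0 ?sqr_ge0 //.
set T := _ / _; have d0 : 0 < nc (z - p.1) ^+ 2.
  by rewrite exprn_gt0 // nc_gt0 subr_eq0 zp // inE eqxx.
have T0 : 0 <= T by rewrite divr_ge0 ?sqr_ge0 // !mulr_ge0 // ltW.
have -> : nc (bfactor p.1 z) ^+ 2 = (1 + T)^-1.
  rewrite /bfactor ncM ncV exprMn exprVn.
  have -> : nc (z - conjc p.1) ^+ 2 = nc (z - p.1) ^+ 2 + 4 * Im z * Im p.1.
    by rewrite !sqr_nc !ReImE; ring.
  have d1 : 0 < nc (z - p.1) ^+ 2 + 4 * Im z * Im p.1.
    by rewrite ltr_wpDr // !mulr_ge0 // ltW.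
  rewrite /T; move: (nc _ ^+ 2) d0 d1 => d d0 d1; field.
  by rewrite !gt_eqF.
rewrite expRN lef_pV2 ?posrE ?expR_gt0 ?expR_ge1Dx //; lra.
Qed.

(** Nonnegative exactly off the balls of radius Im a / 2 about the points a of s;
the 1 stands for the empty minimum. *)
Definition offballs s z : R :=
  foldr (fun p m => Num.min (nc (z - p.1) - Im p.1 / 2) m) 1 s.

Lemma offballs_cont s z : {for z, continuous (offballs s : R[i]^o -> R)}.
Proof.
elim: s z => [|p s IH] z; first by apply: lip_rcont => w; rewrite subrr normr0 nc_ge0.
apply: continuous_minr => // w; apply: lip_rcont => u.
rewrite [X in `|X|](_ : _ = nc (u - p.1) - nc (w - p.1)); last by ring.
by apply: le_trans (ler_dist_nc _ _) _; rewrite opprB addrA subrK.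
Qed.

Lemma offballs_ge0 s z :
  0 <= offballs s z <-> forall p, p \in s -> Im p.1 / 2 <= nc (z - p.1).
Proof.
elim: s => [|p s IH]; first by split => // _; exact: ler01.
rewrite /= le_min subr_ge0; split.
  move=> /andP[zp /IH H] q; rewrite inE => /orP[/eqP ->//|]; exact: H.
move=> H; apply/andP; split; first by apply: H; rewrite inE eqxx.
by apply/IH => q qs; apply: H; rewrite inE qs orbT.
Qed.

Lemma offballs_le0 s z : offballs s z <= 0 ->
  exists2 p, p \in s & nc (z - p.1) <= Im p.1 / 2.
Proof.
elim: s => [|p s IH] /=; first by rewrite ler10.
rewrite ge_min subr_le0 => /orP[H|/IH[q qs H]].
  by exists p => //; rewrite inE eqxx.
by exists q => //; rewrite inE qs orbT.
Qed.

(** The increments of the bounded increasing function (s - r) / (y + |s - r|),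
an antiderivative of y / (y + |s - r|)^2. *)
Lemma telescope_step (y r D s : R) : 0 < y -> 0 < D ->
  D * y / (y + D + `|s - r|) ^+ 2 <=
  (s + D - r) / (y + `|s + D - r|) - (s - r) / (y + `|s - r|).
Proof.
move=> y0 D0; have -> : s + D - r = s - r + D by ring.
move: (s - r) => u.
have au : 0 <= `|u| := normr_ge0 u.
have [u0|u0] := leP 0 u.
  have uD : 0 <= u + D by lra.
  rewrite (ger0_norm u0) (ger0_norm uD).
  have -> : (u + D) / (y + (u + D)) - u / (y + u) = D * y / ((y + (u + D)) * (y + u)).
    by field; apply/andP; split; rewrite gt_eqF; lra.
  rewrite ler_wpM2l ?mulr_ge0 ?(ltW y0) ?(ltW D0) //.
  rewrite lef_pV2 ?posrE ?exprn_gt0 ?mulr_gt0 //; try lra.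
  by rewrite expr2 ler_pM //; lra.
rewrite (ltr0_norm u0); have [uD|uD] := leP (u + D) 0.
  rewrite (ler0_norm uD).
  have -> : (u + D) / (y - (u + D)) - u / (y - u) = D * y / ((y - (u + D)) * (y - u)).
    by field; apply/andP; split; rewrite gt_eqF; lra.
  rewrite ler_wpM2l ?mulr_ge0 ?(ltW y0) ?(ltW D0) //.
  rewrite lef_pV2 ?posrE ?exprn_gt0 ?mulr_gt0 //; try lra.
  by rewrite expr2 ler_pM //; lra.
rewrite (gtr0_norm uD).
have Z0 : 0 < y + D - u by lra.
apply: (@le_trans _ _ (D / (y + D - u))).
  rewrite ler_pdivrMr ?exprn_gt0 // (_ : D / (y + D - u) * (y + D - u) ^+ 2 = D * (y + D - u)).
    by rewrite ler_wpM2l; lra.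
  by field; rewrite gt_eqF.
have P1 : (u + D) / (y + D - u) <= (u + D) / (y + (u + D)).
  by rewrite ler_wpM2l; [|lra|rewrite lef_pV2 ?posrE; lra].
have P2 : - u / (y + D - u) <= - u / (y - u).
  by rewrite ler_wpM2l; [|lra|rewrite lef_pV2 ?posrE; lra].
have -> : D / (y + D - u) = (u + D) / (y + D - u) + - u / (y + D - u).
  by rewrite -mulrDl; congr (_ / _); ring.
by rewrite mulNr in P2 *; lra.
Qed.

Lemma telescope_range (y r s : R) : 0 < y -> -1 <= (s - r) / (y + `|s - r|) <= 1.
Proof.
move=> y0; have : `|s - r| <= y + `|s - r| by lra.
have p : 0 < y + `|s - r| by have := normr_ge0 (s - r); lra.
by rewrite ler_pdivlMr // ler_pdivrMr // mulN1r mul1r -ler_norml.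
Qed.

Lemma nat_between (r : R) : 1 / 2 <= r -> exists m : nat, r <= m%:R <= 2 * r.
Proof.
move=> r2; have r0 : 0 <= 2 * r by lra.
have /andP[m1 m2] := truncn_itv r0; set m := Num.truncn _ in m1 m2.
exists m; rewrite m1 andbT; move: m2; rewrite -natr1 => m2.
have : 1 <= m%:R :> R by rewrite ler1n lt0n; apply/eqP => m00; move: m2; rewrite m00; lra.
lra.
Qed.

End Balls.

Section OneComponentSeparated.
Context {R : realType}.
Variables (A : set (seq (R[i] * nat))) (Theta : R[i] -> R[i]) (F phi : R -> R).
Hypothesis hB : blaschke_product A Theta F.
Hypothesis phiD : forall x : R, is_derive x 1 phi (F x).
Hypothesis phi_incr : {homo phi : x y / x < y}.
Hypothesis FD : forall x : R, derivable F x 1.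
Implicit Types (x y t : R) (z w : R[i]).

Lemma inner_le1 z : 0 <= Im z -> nc (Theta z) <= 1.
Proof.
move=> z0; have [s As _] := bp_density_ge hB 0 ltr01.
exact: le_trans (bp_le hB As z0) (blaschke_le1 (bp_uhp hB As) z0).
Qed.

(** The inequality 1 - |B|^2 <= bmass for finite sub-products passes to the limit. *)
Lemma inner_ge x y : 0 < y -> 1 - nc (Theta (x +i* y)) ^+ 2 <= 4 * y * F x.
Proof.
move=> y0; rewrite lerBlDr; apply/ler_addgt0Pr => e e0.
pose e1 := Num.min 1 (e / 3).
have e1_gt0 : 0 < e1 by rewrite lt_min ltr01 divr_gt0.
have e1_le1 : e1 <= 1 by rewrite ge_min lexx.
have e1_le : e1 <= e / 3 by rewrite ge_min lexx orbT.
clearbody e1; have zi : 0 <= Im (x +i* y) by rewrite ltW.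
have [//|s As Hs] := bp_ge hB (_ : 0 < Im (x +i* y)) e1_gt0.
have H1 := blaschke_ge (bp_uhp hB As) zi.
have H2 := bmass_le_density x (bp_uhp hB As) (ltW y0).
have H3 : 4 * y * density s x <= 4 * y * F x.
  by rewrite ler_wpM2l ?(bp_density_le hB) // mulr_ge0 // ltW.
have H4 : nc (blaschke s (x +i* y)) ^+ 2 <= (nc (Theta (x +i* y)) + e1) ^+ 2.
  by rewrite lerXn2r ?nnegrE ?addr_ge0 ?nc_ge0 // ltW.
have T1 := inner_le1 zi; have T0 := nc_ge0 (Theta (x +i* y)).
have H5 : (nc (Theta (x +i* y)) + e1) ^+ 2 <= nc (Theta (x +i* y)) ^+ 2 + 3 * e1.
  move: T0 T1; move: (nc (Theta _)) => u u0 u1.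
  have : e1 * u <= e1 * 1 by rewrite ler_wpM2l // ltW.
  have : e1 * e1 <= e1 * 1 by rewrite ler_wpM2l // ltW.
  lra.
lra.
Qed.

(** A small value of Theta spreads to a hyperbolic ball around its point,
because the sum bmass satisfies Harnack's inequality. *)
Lemma small_on_ball (e : R) w z : 0 < e -> 0 < Im w -> nc (Theta w) < e ->
  nc (z - w) <= Im w / 2 ->
  nc (Theta z) ^+ 2 <= expR (- (2 / 9 * (1 - e ^+ 2))).
Proof.
move=> e0 w0 we zw.
have e1 : 0 < e - nc (Theta w) by lra.
have [s As Hs] := bp_ge hB w0 e1.
have Hs' := bp_uhp hB As.
have zIm : Im w / 2 <= Im z.
  have := le_trans (ler_Im_nc _) zw; rewrite ImB ler_norml; lra.
have z0 : 0 <= Im z by lra.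
have Bw : nc (blaschke s w) ^+ 2 <= e ^+ 2.
  rewrite lerXn2r ?nnegrE ?nc_ge0 ?(ltW e0) //; lra.
have Mw := blaschke_ge Hs' (ltW w0).
have Mz : 2 / 9 * bmass s w <= bmass s z.
  rewrite /bmass mulr_sumr big_seq [leRHS]big_seq; apply: ler_sum => p ps.
  have p0 := Hs' p ps; rewrite mulrCA ler_wpM2l // /bdefect.
  have nw := nc_sub_conj_gt0 p0 (ltW w0); have nz := nc_sub_conj_gt0 p0 z0.
  have wn : Im w <= nc (w - conjc p.1).
    apply: le_trans (ler_Im_nc _); rewrite ImB Im_conj opprK ger0_norm; lra.
  have le1 : nc (z - conjc p.1) <= 3 / 2 * nc (w - conjc p.1).
    apply: le_trans (ler_nc_dist w _ _) _; lra.
  have le2 : nc (z - conjc p.1) ^+ 2 <= 9 / 4 * nc (w - conjc p.1) ^+ 2.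
    have -> : 9 / 4 * nc (w - conjc p.1) ^+ 2 = (3 / 2 * nc (w - conjc p.1)) ^+ 2 by field.
    by rewrite lerXn2r ?nnegrE ?mulr_ge0 ?nc_ge0.
  rewrite mulrA ler_pdivrMr ?exprn_gt0 // [leRHS]mulrAC ler_pdivlMr ?exprn_gt0 //.
  apply: (@le_trans _ _ (2 / 9 * (4 * Im w * Im p.1) * (9 / 4 * nc (w - conjc p.1) ^+ 2))).
    by rewrite ler_wpM2l // !mulr_ge0 // ltW.
  have -> : 2 / 9 * (4 * Im w * Im p.1) * (9 / 4 * nc (w - conjc p.1) ^+ 2) =
    4 * (Im w / 2) * Im p.1 * nc (w - conjc p.1) ^+ 2 by field.
  by rewrite ler_wpM2r ?sqr_ge0 // ler_wpM2r ?(ltW p0) // ler_wpM2l.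
apply: (@le_trans _ _ (nc (blaschke s z) ^+ 2)).
  by rewrite lerXn2r ?nnegrE ?nc_ge0 // (bp_le hB As).
apply: le_trans (blaschke_le_exp Hs' z0) _; rewrite ler_expR lerN2; lra.
Qed.

(** If Theta is small on balls around the points of s, a power of Theta is
dominated by the finite Blaschke product with zeros at these points: their
quotient is bounded by 1 on the real line, at infinity and on the balls. *)
Lemma inner_pow_le (s : seq (R[i] * nat)) (N : nat) (T b : R) :
  in_uhp s ->
  (forall z, 0 <= Im z -> 0 <= offballs s z -> btail s z <= T) ->
  (forall p z, p \in s -> nc (z - p.1) <= Im p.1 / 2 -> nc (Theta z) ^+ 2 <= expR (- b)) ->
  T <= N%:R * b ->
  forall z, 0 <= Im z -> 0 <= offballs s z -> nc (Theta z) ^+ N <= nc (blaschke s z).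
Proof.
move=> Hs HT Hb TN z z0 zs.
have neq w : 0 <= offballs s w -> forall p, p \in s -> w != p.1.
  move=> /offballs_ge0 H p ps; rewrite -subr_eq0 -nc_gt0; apply: lt_le_trans (H p ps).
  by rewrite divr_gt0 // Hs.
have Bpos w : 0 <= Im w -> 0 <= offballs s w -> 0 < nc (blaschke s w).
  move=> w0 ws; have := blaschke_ge_exp Hs w0 (neq w ws).
  have := expR_gt0 (- btail s w); have := nc_ge0 (blaschke s w).
  rewrite le_eqVlt => /orP[/eqP <-|//]; rewrite expr0n /=; lra.
rewrite -[leRHS]mul1r -ler_pdivrMr ?Bpos // -ncX -ncV -ncM.
pose g w := Num.min (Im w) (offballs s w).
have gP w : 0 <= g w -> 0 <= Im w /\ 0 <= offballs s w by rewrite le_min => /andP[].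
apply: (@maximum_principle_infinity _ (fun w => Theta w ^+ N / blaschke s w) g) => //.
- by apply: continuous_minr => w; [exact: cont_Im|exact: offballs_cont].
- move=> w /gP[w0 ws]; apply: cdiff_div; first by rewrite -nc_gt0 Bpos.
    exact/cdiffX/(bp_cdiff hB).
  exact: cdiff_blaschke.
- move=> w gw; have [w0 ws] : 0 <= Im w /\ 0 <= offballs s w by apply: gP; rewrite gw.
  rewrite ncM ncV ncX ler_pdivrMr ?Bpos // mul1r.
  have [I0|Ipos] := eqVneq (Im w) 0.
    by rewrite (real_eq I0) (bp_real hB) expr1n blaschke_real.
  have : offballs s w <= 0.
    by move: gw; rewrite /g; case: (leP (Im w) (offballs s w)) => [_ I0|_ -> //]; move: Ipos; rewrite I0 eqxx.
  move=> /offballs_le0[p ps wp].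
  rewrite -(@ler_pXn2r _ 2) ?nnegrE ?exprn_ge0 ?nc_ge0 // exprAC.
  apply: le_trans (blaschke_ge_exp Hs w0 (neq w ws)).
  apply: (@le_trans _ _ (expR (- b) ^+ N)).
    by rewrite lerXn2r ?nnegrE ?expR_ge0 ?sqr_ge0 // (Hb p).
  rewrite -expRM_natl ler_expR mulrN lerN2; exact: le_trans (HT w w0 ws) TN.
- move=> e e0; have [K HK] := blaschke_infinity Hs e0.
  exists K => w /gP[w0 ws] Kw; rewrite ncM ncV ncX ler_pdivrMr ?Bpos //.
  apply: le_trans (HK w w0 Kw); by rewrite exprn_ile1 ?nc_ge0 // inner_le1.
- by rewrite le_min z0 zs.
Qed.

Lemma crossing (L : set R[i]) x a b (r : R) : connected (L : set R[i]^o) ->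
  L a -> L b -> nc (a - x%:C) <= r <= nc (b - x%:C) ->
  exists2 w, L w & nc (w - x%:C) = r.
Proof.
move=> Lc La Lb rab; pose h (w : R[i]^o) : R := nc (w - x%:C).
have hc : continuous h.
  move=> w; apply: lip_rcont => u; apply: le_trans (ler_dist_nc _ _) _.
  by rewrite opprB addrA subrK.
have /connected_intervalP I := connected_continuous_connected Lc (continuous_subspaceT hc).
have [w Lw <-] : [set h w | w in L] r.
  by apply: I rab; [exists a|exists b].
by exists w.
Qed.

(** Off the balls, the distance of z to W j is at least a fifth of
y + D + |d + j D - r|, with y = Im z, r = |z - x| and D = d / n the step of the grid.
The sum is then dominated by a Riemann sum of y / (y + |s - r|)^2, which
telescopes. *)
Lemma btail_le_grid x (W : nat -> R[i]) (m : nat -> nat) (d h0 : R) (n : nat) :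
  0 < d -> 0 < h0 -> (0 < n)%N -> 2 * d <= n%:R * h0 ->
  (forall j : nat, (j < n)%N ->
    [/\ nc (W j - x%:C) = d + j%:R * (d / n%:R), h0 <= Im (W j) &
      (m j)%:R * Im (W j) <= 2 * d]) ->
  forall z, 0 <= Im z -> 0 <= offballs [seq (W j, m j) | j <- index_iota 0 n] z ->
  btail [seq (W j, m j) | j <- index_iota 0 n] z <= 400 * n%:R.
Proof.
move=> d0 h0_gt0 n0 nh HW z z0 zs; set y := Im z in z0 *.
have n0' : 0 < n%:R :> R by rewrite ltr0n.
pose D := d / n%:R; have D0 : 0 < D by rewrite divr_gt0.
have dE : d = n%:R * D by rewrite /D mulrC divfK // gt_eqF.
have Dh : 2 * D <= h0 by rewrite /D mulrA ler_pdivrMr // [leRHS]mulrC.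
rewrite /btail big_map; move: z0; rewrite le_eqVlt => /orP[/eqP y0|y0].
  rewrite big1; first by apply: mulr_ge0 (ler0n _ _) (ltW n0').
  by move=> j _; rewrite -/y -y0 mulr0 !mul0r mulr0.
pose r := nc (z - x%:C).
pose f j : R := (d + j%:R * D - r) / (y + `|d + j%:R * D - r|).
have fr j : -1 <= f j <= 1 by exact: telescope_range.
apply: (@le_trans _ _ (\sum_(0 <= j < n) 200 * n%:R * (f j.+1 - f j))); last first.
  rewrite -mulr_sumr telescope_sumr //.
  have : f n - f 0%N <= 2 by have := fr n; have := fr 0%N; lra.
  move=> /(ler_wpM2l (_ : 0 <= 200 * n%:R)) => /(_ (mulr_ge0 (ler0n _ _) (ltW n0'))); lra.
rewrite big_nat [leRHS]big_nat; apply: ler_sum => j /andP[_ jn].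
have [Wj hj mj] := HW j jn.
have Aj : Im (W j) / 2 <= nc (z - W j).
  move/offballs_ge0: zs => /(_ (W j, m j)); apply; apply/mapP.
  by exists j => //; rewrite mem_index_iota.
rewrite -/y; set a := nc (z - W j) in Aj *.
have a0 : 0 < a by lra.
have ya : y <= 3 * a.
  have : `|Im z - Im (W j)| <= a by rewrite -ImB ler_Im_nc.
  by rewrite -/y ler_norml; lra.
have ra : `|d + j%:R * D - r| <= a.
  rewrite -Wj /r; apply: le_trans (ler_dist_nc _ _) _.
  by rewrite opprB addrA subrK nc_distC.
have step := @telescope_step _ y r D (d + j%:R * D) y0 D0.
have fS : f j.+1 = (d + j%:R * D + D - r) / (y + `|d + j%:R * D + D - r|).
  have jE : j.+1%:R = j%:R + 1 :> R by rewrite natr1.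
  by rewrite /f jE [(j%:R + 1) * D]mulrDl mul1r !addrA.
rewrite fS; apply: (@le_trans _ _ (200 * n%:R * (D * y / (y + D + `|d + j%:R * D - r|) ^+ 2))); last first.
  by apply: ler_wpM2l step; exact: mulr_ge0 (ler0n _ _) (ltW n0').
set q := y + D + _; have q0 : 0 < q by rewrite ltr_wpDr //; lra.
have q5 : q <= 5 * a by rewrite /q; lra.
have q25 : q ^+ 2 <= 25 * a ^+ 2.
  have -> : 25 * a ^+ 2 = (5 * a) ^+ 2 by ring.
  by rewrite lerXn2r ?nnegrE //; lra.
have -> : (m j)%:R * (4 * y * Im (W j) / a ^+ 2) = ((m j)%:R * Im (W j)) * (4 * y) / a ^+ 2 by ring.
have -> : 200 * n%:R * (D * y / q ^+ 2) = 200 * d * y / q ^+ 2 by rewrite dE; ring.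
rewrite ler_pdivrMr ?exprn_gt0 // [leRHS]mulrAC ler_pdivlMr ?exprn_gt0 //.
apply: (@le_trans _ _ (2 * d * (4 * y) * (25 * a ^+ 2))); last by lra.
apply: ler_pM => //; rewrite ?sqr_ge0 //.
  by rewrite !mulr_ge0 //; lra.
by rewrite ler_wpM2r //; lra.
Qed.

(** A connected level set containing the zero a and zeros near infinity meets
every circle about x of radius at least d = |x - a|.  The finite Blaschke
product with zeros w_j on the circles of radii d + j d / n and multiplicities
m_j comparable to d / Im w_j dominates a power of Theta; being small at
x + i d / 2, it bounds F x from below. *)
Lemma one_component_separated : one_component Theta ->
  (forall K : R, exists w, [/\ 0 < Im w, Theta w = 0 & K <= nc w]) ->
  exists2 c, 0 < c & separated A F c.
Proof.
move=> [e [e0 e1 Lc]] unb.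
pose L := [set z : R[i] | 0 < Im z /\ nc (Theta z) < e].
have {}Lc : connected (L : set R[i]^o).
  move: Lc; congr connected; apply/seteqP.
  by split => z; rewrite /L /upper_half_plane /= norm_nc ltcR.
(* on the balls |Theta|^2 <= exp (- b) by small_on_ball *)
pose s0 := 1 - e ^+ 2.
have s0_gt0 : 0 < s0 by rewrite subr_gt0 exprn_ilt1 // ltW.
pose b := 2 / 9 * s0; have b0 : 0 < b by rewrite mulr_gt0.
(* Theta^(q n) beats the bound 400 n of btail_le_grid on the balls *)
pose q := (Num.bound (400 / b)).+1.
have qb : 400 <= q%:R * b.
  rewrite -ler_pdivrMr // /q -[leRHS]natr1.
  have P : 0 <= 400 / b := divr_ge0 (ler0n _ _) (ltW b0).
  by have := archi_boundP P; lra.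
have q0 : 0 < q%:R :> R by rewrite ltr0n.
(* the finite product is at most exp (- 4 n / 25) at x + i d / 2 *)
pose k : R := 8 / (25 * q%:R).
have k0 : 0 < k by rewrite divr_gt0 // mulr_gt0.
have kb : k <= b.
  rewrite /k ler_pdivrMr ?mulr_gt0 //; have : 400 <= b * q%:R by rewrite mulrC.
  lra.
exists ((1 - expR (- k)) / 2); first by rewrite divr_gt0 // subr_gt0 expR_lt1 oppr_lt0.
move=> s p x As ps p2; set a := p.1; set d := nc _.
have a0 : 0 < Im a := bp_uhp hB As ps.
have d0 : 0 < d.
  rewrite nc_gt0 subr_eq0; apply/eqP => /(congr1 (@Im R)) /=; lra.
have da : nc (a - x%:C) = d by rewrite nc_distC.
have La : L a.
  split => //; have := bp_le hB As (ltW a0); rewrite /blaschke (big_rem p ps) /=.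
  rewrite -/a /bfactor subrr mul0r expr0n eqn0Ngt p2 /= mul0r nc0; lra.
have [b' Lb' bfar] : exists2 b', L b' & 2 * d <= nc (b' - x%:C).
  have [w [w0 Tw wK]] := unb (2 * d + `|x|); exists w; first by split => //; rewrite Tw nc0.
  have := ler_dist_nc w x%:C; rewrite nc_real ler_norml; lra.
have cross (r : R) : exists w, d <= r <= 2 * d -> L w /\ nc (w - x%:C) = r.
  have [rd|] := pselect (d <= r <= 2 * d); last by exists 0.
  have [|w Lw wr] := @crossing L x a b' r Lc La Lb'; last by exists w.
  rewrite da; lra.
have [W0 HW0] := choice cross.
(* heights of the level set in the disc are bounded below by inner_ge *)
have [h0 h0_gt0 Hh] : exists2 h0, 0 < h0 &
    forall w, L w -> nc (w - x%:C) <= 2 * d -> h0 <= Im w.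
  have I : x - 2 * d <= x + 2 * d by lra.
  have [c cI Hc] := EVT_max I (continuous_subspaceT (phase_continuous FD)).
  have F0 : 0 < F c := phase_gt0 hB phiD phi_incr c.
  exists (s0 / (4 * F c)); first by rewrite divr_gt0 // mulr_gt0.
  move=> w [w0 we] wd; rewrite ler_pdivrMr ?mulr_gt0 //.
  have wE : w = Re w +i* Im w by case: (w).
  have := inner_ge (Re w) w0; rewrite -wE.
  have T2 : nc (Theta w) ^+ 2 <= e ^+ 2 by rewrite lerXn2r ?nnegrE ?nc_ge0 ?(ltW e0) // ltW.
  have FF : F (Re w) <= F c.
    apply: Hc; rewrite in_itv /=; have := le_trans (ler_Re_nc _) wd.
    by rewrite ReB /= ler_norml; lra.
  have : 4 * Im w * F (Re w) <= 4 * Im w * F c by rewrite ler_wpM2l // mulr_ge0 // ltW.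
  rewrite /s0; lra.
(* a grid finer than the radii of the balls *)
pose n := (Num.bound (2 * d / h0)).+1.
have n0 : 0 < n%:R :> R by rewrite ltr0n.
have nh : 2 * d <= n%:R * h0.
  rewrite -ler_pdivrMr // /n -[leRHS]natr1.
  have P : 0 <= 2 * d / h0 by rewrite divr_ge0 ?mulr_ge0 // ltW.
  by have := archi_boundP P; lra.
pose W (j : nat) := W0 (d + j%:R * (d / n%:R)).
have HW j : (j < n)%N -> L (W j) /\ nc (W j - x%:C) = d + j%:R * (d / n%:R).
  move=> jn; apply: HW0.
  have : 0 <= j%:R * (d / n%:R) by rewrite mulr_ge0 // divr_ge0 // ltW.
  have : j%:R * (d / n%:R) <= d.
    by rewrite mulrA ler_pdivrMr // mulrC ler_wpM2l ?(ltW d0) // ler_nat ltnW.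
  lra.
have W2d j : (j < n)%N -> nc (W j - x%:C) <= 2 * d.
  move=> jn; have [_ ->] := HW j jn.
  have : j%:R * (d / n%:R) <= d.
    by rewrite mulrA ler_pdivrMr // mulrC ler_wpM2l ?(ltW d0) // ler_nat ltnW.
  lra.
have Wy j : (j < n)%N -> Im (W j) <= 2 * d.
  move=> jn; apply: le_trans (W2d j jn); apply: le_trans (ler_Im_nc _).
  by rewrite ImB /= subr0 ler_norm.
have exm j : exists m : nat, (j < n)%N -> d <= m%:R * Im (W j) <= 2 * d.
  have [jn|] := boolP (j < n)%N; last by exists 0%N.
  have [[i0 _] _] := HW j jn; have i2 := Wy j jn.
  have [|m Hm] := @nat_between _ (d / Im (W j)).
    by rewrite ler_pdivlMr //; lra.
  exists m => _; move: Hm => /andP[m1 m2]; apply/andP; split.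
    by rewrite -ler_pdivrMr.
  by rewrite -ler_pdivlMr // -mulrA.
have [m Hm] := choice exm.
pose sw := [seq (W j, m j) | j <- index_iota 0 n].
have mem_sw p' : p' \in sw -> exists2 j, (j < n)%N & p' = (W j, m j).
  by move=> /mapP[j]; rewrite mem_index_iota => jn ->; exists j.
have sw_uhp : in_uhp sw by move=> p' /mem_sw[j /HW[[i0 _] _] ->].
have tail z : 0 <= Im z -> 0 <= offballs sw z -> btail sw z <= 400 * n%:R.
  apply: (@btail_le_grid x W m d h0 n) => // j jn.
  have [Lj rj] := HW j jn; split => //; first exact: Hh (W2d j jn).
  by have /andP[] := Hm j jn.
have ball p' z : p' \in sw -> nc (z - p'.1) <= Im p'.1 / 2 ->
    nc (Theta z) ^+ 2 <= expR (- b).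
  move=> /mem_sw[j /HW[[i0 we] _] ->] /= zw; exact: small_on_ball we zw.
pose z0 := x +i* (d / 2).
have z0_gt0 : 0 < Im z0 by rewrite /= divr_gt0.
suff small : nc (Theta z0) ^+ 2 <= expR (- k).
  have := @inner_ge x (d / 2) z0_gt0; rewrite -/z0; lra.
have [off|on] := leP 0 (offballs sw z0); last first.
  have [p' p's H] := offballs_le0 (ltW on).
  by apply: le_trans (ball p' z0 p's H) _; rewrite ler_expR lerN2.
have TN : 400 * n%:R <= (q * n)%:R * b.
  rewrite natrM; have : 400 * n%:R <= q%:R * b * n%:R by rewrite ler_wpM2r // ltW.
  lra.
have := inner_pow_le sw_uhp tail ball TN (ltW z0_gt0) off.
set T := nc (Theta z0); have T0 : 0 <= T := nc_ge0 _ => TB.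
have BM := blaschke_le_exp sw_uhp (ltW z0_gt0).
have M : n%:R * (8 / 25) <= bmass sw z0.
  rewrite /bmass big_map big_nat.
  apply: (@le_trans _ _ (\sum_(0 <= j < n | (0 <= j < n)%N) (8 / 25))).
    by rewrite -big_nat sumr_const_nat subn0 mulr_natl.
  apply: ler_sum => j /andP[_ jn]; have [[i0 _] _] := HW j jn.
  have /andP[m1 _] := Hm j jn; rewrite /bdefect.
  have n1 := nc_sub_conj_gt0 i0 (ltW z0_gt0).
  have zd : nc (z0 - conjc (W j)) <= 5 / 2 * d.
    apply: le_trans (ler_nc_dist x%:C _ _) _; rewrite nc_real_conj nc_distC.
    rewrite [nc (x%:C - W j)]nc_distC; have := W2d j jn.
    have -> : nc (x%:C - z0) = d / 2; last by lra.
    have -> : x%:C - z0 = - ('i * (d / 2)%:C) by apply: complex_eqP; rewrite !ReImE /=; ring.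
    by rewrite ncN ncM nc_real gtr0_norm ?divr_gt0 // /= expr0n expr1n add0r sqrtr1 mul1r.
  have zd2 : nc (z0 - conjc (W j)) ^+ 2 <= 25 / 4 * d ^+ 2.
    have -> : 25 / 4 * d ^+ 2 = (5 / 2 * d) ^+ 2 by field.
    by rewrite lerXn2r ?nnegrE ?nc_ge0 // mulr_ge0 // ltW.
  have -> : (m j)%:R * (4 * Im z0 * Im (W j) / nc (z0 - conjc (W j)) ^+ 2) =
    2 * d * ((m j)%:R * Im (W j)) / nc (z0 - conjc (W j)) ^+ 2 by rewrite /=; field; rewrite gt_eqF.
  rewrite ler_pdivlMr ?exprn_gt0 //.
  have : 2 * d * d <= 2 * d * ((m j)%:R * Im (W j)) by rewrite ler_wpM2l // mulr_ge0 // ltW.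
  move: zd2; rewrite expr2; lra.
have N0 : (0 < q * n)%N by [].
rewrite -(@ler_pXn2r _ (q * n)) ?nnegrE ?sqr_ge0 ?expR_ge0 // exprAC.
apply: (@le_trans _ _ (nc (blaschke sw z0) ^+ 2)).
  by rewrite lerXn2r ?nnegrE ?exprn_ge0 ?nc_ge0.
apply: le_trans BM _; rewrite -expRM_natl ler_expR mulrN lerN2.
apply: le_trans M; rewrite natrM /k le_eqVlt; apply/orP; left; apply/eqP.
by field; rewrite gt_eqF.
Qed.

End OneComponentSeparated.

(** * The equivalence *)

Theorem corollary1 (R : realType) (E : R[i] -> R[i]) (phi : R -> R) (sigma : R)
  (hE : hermite_biehler E)
  (hphi : phase_function E phi)
  (hsigma : phase_sigma E phi sigma)
  (sigma0 : sigma = 0)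
  (hzeros : zeros_tend_to_infinity E) :
  locally_doubling (density_measure (derive1 phi)) <->
  one_component (fun z : R[i] => star E z / E z).
Proof.
rewrite sigma0 in hsigma.
have hB := HB_blaschke_product hE hphi hsigma.
have phiD := is_derive_phase hphi.
have [smooth incr _] := hphi.
have FD x : derivable (derive1 phi) x 1 := smooth 1%N x.
split => [dbl|oc].
  have [c c0 sep] := doubling_separated hB phiD incr FD dbl.
  exact: (separated_one_component hB phiD incr FD c0 sep).
have [K|c c0 sep] := one_component_separated hB phiD incr FD oc.
  have [u [uE /cvgryPge/(_ K)[n _ uK]]] := hzeros.
  exists (conjc (u n)); split.
  - by rewrite Im_conj oppr_gt0; exact: (zeros_lower hE (uE n)).
  - by rewrite /star conjcK (uE n : E (u n) = 0) conjc0 mul0r.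
  - by rewrite nc_conj; apply: uK => /=.
exact: (separated_doubling hB phiD incr FD c0 sep).
Qed.
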